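(* Let $k$ be a field of characteristic zero. The following statements are equivalent: (i) For every $n\geq 1$ and every $A\in\operatorname{GL}_n(k(z))$ the rational map $\sigma\colon X\dashrightarrow X$ on $X=\mathbb{A}^1_k\times\operatorname{GL}_{n,k}$ defined by $\sigma(b,B)=(b+1,A(b)B)$ has the following property: for every closed subvariety $Y\subset X$ and every $x\in X(k)$ with $\mathcal{O}_\sigma(x)$ defined, the set $\{i\in\mathbb{N}\mid \sigma^i(x)\in Y\}$ is a finite union of arithmetic progressions. (ii) For every solution $f\in k^{\mathbb{N}}$ of a linear difference equation $$\sigma^n(y)+h_{n-1}\sigma^{n-1}(y)+\cdots+h_0y=0$$ with $n\geq 1$ and $h_{n-1},\ldots,h_0\in k(z)$, the set $\{i\in\mathbb{N}\mid f(i)=0\}$ is a finite union of arithmetic progressions. (iii) For every $n\geq 1$ and every $A\in\operatorname{GL}_n(k(z))$ there exists a Picard-Vessiot extension of $k(z)$ for $\sigma(y)=Ay$ inside $\operatorname{Seq}_k$.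
   Context: $\mathbb{N}=\{0,1,2,\ldots\}$. An arithmetic progression is a subset of $\mathbb{N}$ of the form $j+\mathbb{N}l$ with $j,l\in\mathbb{N}$ ($l=0$ allowed, so singletons are arithmetic progressions; the empty set is the empty union). A solution $f\in k^{\mathbb{N}}$ of $\sigma^n(y)+h_{n-1}\sigma^{n-1}(y)+\cdots+h_0y=0$ is a sequence $f\colon\mathbb{N}\to k$ with $f(i+n)+h_{n-1}(i)f(i+n-1)+\cdots+h_0(i)f(i)=0$ for all $i\gg 0$. Orbits: for a rational map $\sigma\colon X\dashrightarrow X$, let $U\subset X$ be the largest open subset on which $\sigma$ is defined; $\mathcal{O}_\sigma(x)$ is defined if $x\in U,\ \sigma(x)\in U,\ \sigma^2(x)\in U,\ldots$. (For the map in (i) this means that for $x=(b,B)$ and every $i\in\mathbb{N}$, no entry of $A$ has a pole at $b+i$ and $\det(A)(b+i)\neq 0$.) A closed subvariety $Y\subset X$ is the zero locus in $X$ of a finite set of elements of the coordinate ring $k[z,Z_{ij},\frac{1}{\det(Z)}]$ of $X$; it need not be irreducible. Difference algebra: all rings are commutative. A $\sigma$-ring is a ring $R$ with a ring endomorphism $\sigma\colon R\to R$; morphisms of $\sigma$-rings commute with $\sigma$; a $\sigma$-field is a $\sigma$-ring that is a field; $R^\sigma=\{r\in R\mid \sigma(r)=r\}$. The field $k(z)$ is a $\sigma$-field via the automorphism $\sigma(h(z))=h(z+1)$. A $\sigma$-pseudo field is a $\sigma$-ring $L$ for which there exist orthogonal idempotents $e_0,\ldots,e_{l-1}\in L$ with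 $L=e_0L\oplus\cdots\oplus e_{l-1}L$, $\sigma(e_0)=e_1,\ \sigma(e_1)=e_2,\ldots,\sigma(e_{l-1})=e_0$, and each $e_iL$ a field. Let $K$ be a $\sigma$-field and $A\in\operatorname{GL}_n(K)$. A $\sigma$-pseudo field extension $L$ of $K$ is a Picard-Vessiot extension for $\sigma(y)=Ay$ if (1) there is $Y\in\operatorname{GL}_n(L)$ with $\sigma(Y)=AY$ such that $L$ is the total ring of fractions of $K[Y_{ij}]$ (written $L=K(Y_{ij})$), and (2) $L^\sigma=K^\sigma$. $\operatorname{Seq}_k$ is the ring of sequences $f\colon\mathbb{N}\to k$ modulo the identification of $f$ and $g$ if $f(i)=g(i)$ for all $i\gg 0$, with componentwise addition and multiplication, and with $\sigma(f)=(f(1),f(2),\ldots)$. The map $k(z)\to\operatorname{Seq}_k$, $h\mapsto(h(0),h(1),h(2),\ldots)$ (well defined since $h$ has finitely many poles) makes $\operatorname{Seq}_k$ a $k(z)$-$\sigma$-algebra. ''Inside $\operatorname{Seq}_k$'' means a $k(z)$-$\sigma$-subalgebra of $\operatorname{Seq}_k$. *)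

(* Defs.v *)
From HB Require Import structures.
From mathcomp Require Import all_boot all_order all_algebra.
From mathcomp Require Import generic_quotient fraction ring_quotient.
From mathcomp Require Import boolp classical_sets functions.
From mathcomp Require Import mpoly.

Set Implicit Arguments.
Unset Strict Implicit.
Unset Printing Implicit Defensive.

Import GRing.Theory.
Local Open Scope ring_scope.
Local Open Scope quotient_scope.

Definition finite_union_of_AP (P : nat -> Prop) : Prop :=
  exists s : seq (nat * nat),
    forall i : nat, P i <-> exists2 jl, jl \in s & exists m, i = (jl.1 + m * jl.2)%N.

Local Notation "x %:F" := (FracField.tofrac x).

Section RationalFunctions.
Variable k : fieldType.
Notation kz := {fraction {poly k}}.

(* A reduced numerator and denominator of h; they are determined up to a common
   factor in k. *)
Definition frac_gcd (h : kz) : {poly k} := gcdp \n_(repr h) \d_(repr h).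
Definition frac_num (h : kz) : {poly k} := \n_(repr h) %/ frac_gcd h.
Definition frac_den (h : kz) : {poly k} := \d_(repr h) %/ frac_gcd h.

Definition has_pole (h : kz) (a : k) : bool := root (frac_den h) a.

(* The value h(a); it is meaningful only when h has no pole at a. *)
Definition frac_eval (h : kz) (a : k) : k := (frac_num h).[a] / (frac_den h).[a].

Definition frac_shift (h : kz) : kz :=
  (frac_num h \Po ('X + 1))%:F / (frac_den h \Po ('X + 1))%:F.

Lemma frac_gcd_neq0 h : frac_gcd h != 0.
Proof. by rewrite gcdp_eq0 negb_and denom_ratioP orbT. Qed.

Lemma frac_numE h : frac_num h * frac_gcd h = \n_(repr h).
Proof. by rewrite divpK ?dvdp_gcdl. Qed.

Lemma frac_denE h : frac_den h * frac_gcd h = \d_(repr h).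
Proof. by rewrite divpK ?dvdp_gcdr. Qed.

Lemma frac_den_neq0 h : frac_den h != 0.
Proof.
apply/eqP => h0; have := frac_denE h; rewrite h0 mul0r => /esym/eqP.
by apply/negP/denom_ratioP.
Qed.

Lemma coprime_frac h : coprimep (frac_num h) (frac_den h).
Proof. by apply: coprimep_div_gcd; rewrite denom_ratioP orbT. Qed.

Lemma tofrac_neq0 (p : {poly k}) : p != 0 -> p%:F != 0.
Proof. by rewrite tofrac_eq0. Qed.

Lemma repr_frac (h : kz) : h = (\n_(repr h))%:F / (\d_(repr h))%:F.
Proof.
have d0 := denom_ratioP (repr h).
rewrite -[LHS]reprK -[in LHS](Ratio_numden (repr h)); unlock FracField.tofrac.
rewrite -[X in _ * X]FracField.pi_inv -[RHS]FracField.pi_mul.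
rewrite /FracField.mulf /FracField.invf.
by rewrite !(numer_Ratio, denom_Ratio) ?oner_neq0 // ?mulr1 ?mul1r.
Qed.

Lemma frac_num_den h : h = (frac_num h)%:F / (frac_den h)%:F.
Proof.
rewrite [LHS]repr_frac -frac_numE -frac_denE !tofracM.
rewrite -mulf_div divff ?mulr1 // tofrac_neq0 //; exact: frac_gcd_neq0.
Qed.

Lemma frac_cross (h : kz) (p q : {poly k}) : q != 0 -> h = p%:F / q%:F ->
  frac_num h * q = p * frac_den h.
Proof.
move=> q0 hE; apply/eqP; rewrite -tofrac_eq !tofracM.
by rewrite -eqr_div ?tofrac_neq0 ?frac_den_neq0 // -frac_num_den hE.
Qed.

Lemma frac_den_dvd (h : kz) (p q : {poly k}) : q != 0 -> h = p%:F / q%:F ->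
  frac_den h %| q.
Proof.
move=> q0 hE; rewrite -(Gauss_dvdpr q (_ : coprimep _ (frac_num h))).
  by rewrite (frac_cross q0 hE) dvdp_mulIr.
by rewrite coprimep_sym coprime_frac.
Qed.

Lemma frac_evalE (h : kz) (p q : {poly k}) (a : k) : q.[a] != 0 ->
  h = p%:F / q%:F -> ~~ has_pole h a /\ frac_eval h a = p.[a] / q.[a].
Proof.
move=> qa hE; have q0 : q != 0 by apply: contraNneq qa => ->; rewrite horner0.
have da : (frac_den h).[a] != 0.
  have /dvdpP [r rE] := frac_den_dvd q0 hE.
  by move: qa; rewrite rE hornerM mulf_eq0 negb_or => /andP[].
split=> //; apply/eqP; rewrite /frac_eval eqr_div // -!hornerM.
by rewrite (frac_cross q0 hE).
Qed.

Lemma comp_neq0 (p : {poly k}) : p != 0 -> p \Po ('X + 1) != 0.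
Proof. by move=> p0; rewrite comp_poly2_eq0 // -polyC1 size_XaddC. Qed.

Lemma frac_shiftE (h : kz) (p q : {poly k}) : q != 0 -> h = p%:F / q%:F ->
  frac_shift h = (p \Po ('X + 1))%:F / (q \Po ('X + 1))%:F.
Proof.
move=> q0 hE; apply/eqP; rewrite /frac_shift eqr_div; last 2 first.
- exact/tofrac_neq0/comp_neq0/frac_den_neq0.
- exact/tofrac_neq0/comp_neq0.
by rewrite -!tofracM tofrac_eq -!comp_polyM (frac_cross q0 hE).
Qed.

Lemma fracB (h g : kz) : h - g =
  (frac_num h * frac_den g - frac_num g * frac_den h)%:F
    / (frac_den h * frac_den g)%:F.
Proof.
rewrite tofracB !tofracM -!mulNr -addf_div ?tofrac_neq0 ?frac_den_neq0 //.
by rewrite mulNr -!frac_num_den.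
Qed.

Lemma fracM (h g : kz) : h * g =
  (frac_num h * frac_num g)%:F / (frac_den h * frac_den g)%:F.
Proof. by rewrite !tofracM -mulf_div -!frac_num_den. Qed.

Lemma frac1 : 1 = 1%:F / 1%:F :> kz.
Proof. by rewrite tofrac1 divr1. Qed.

Lemma frac_shift_is_zmod_morphism : zmod_morphism frac_shift.
Proof.
move=> h g; rewrite (frac_shiftE _ (fracB h g)) ?mulf_neq0 ?frac_den_neq0 //.
rewrite comp_polyB !comp_polyM tofracB !tofracM /frac_shift -mulNr.
by rewrite -addf_div ?mulNr // tofrac_neq0 // comp_neq0 // frac_den_neq0.
Qed.

Lemma frac_shift_is_monoid_morphism : monoid_morphism frac_shift.
Proof.
split=> [|h g].
  by rewrite (frac_shiftE _ frac1) ?oner_neq0 // rmorph1 tofrac1 divr1.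
rewrite (frac_shiftE _ (fracM h g)) ?mulf_neq0 ?frac_den_neq0 //.
by rewrite !comp_polyM !tofracM /frac_shift mulf_div.
Qed.

HB.instance Definition _ :=
  GRing.isZmodMorphism.Build kz kz frac_shift frac_shift_is_zmod_morphism.
HB.instance Definition _ :=
  GRing.isMonoidMorphism.Build kz kz frac_shift frac_shift_is_monoid_morphism.

End RationalFunctions.

Section Sequences.
Variable k : fieldType.

Definition eventually_zero : {pred nat -> k} :=
  fun f => `[< exists N, forall i, (N <= i)%N -> f i = 0 >].

Lemma eventually_zero_idealr : idealr_closed eventually_zero.
Proof.
split=> [||a u v /asboolP[N uN] /asboolP[M vM]].
- by apply/asboolP; exists 0%N.
- apply/negP => /asboolP[N /(_ N (leqnn N))] /eqP.
  by apply/negP; exact: oner_neq0.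
- apply/asboolP; exists (maxn N M) => i; rewrite geq_max => /andP[Ni Mi].
  by rewrite -[LHS]/(a i * u i + v i) uN // vM // mulr0 addr0.
Qed.

HB.instance Definition _ :=
  isIdealr.Build (nat -> k) eventually_zero eventually_zero_idealr.

Definition Seq := {ideal_quot eventually_zero}.
HB.instance Definition _ := GRing.ComNzRing.on Seq.

Definition to_Seq (f : nat -> k) : Seq := \pi_({ideal_quot eventually_zero}) f.

Lemma to_SeqP f g :
  to_Seq f = to_Seq g <-> exists N, forall i, (N <= i)%N -> f i = g i.
Proof.
have E : (to_Seq f == to_Seq g) = (f - g \in eventually_zero).
  by rewrite Quotient.idealrBE.
split=> [/eqP|[N fg]]; rewrite ?E.
  by move=> /asboolP[N fg]; exists N => i /fg /eqP; rewrite subr_eq0 => /eqP.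
by apply/eqP; rewrite E; apply/asboolP; exists N => i /fg fgi; apply/eqP; rewrite subr_eq0 fgi.
Qed.

Lemma to_SeqB f g : to_Seq (f - g) = to_Seq f - to_Seq g.
Proof. exact: rmorphB. Qed.
Lemma to_SeqM f g : to_Seq (f * g) = to_Seq f * to_Seq g.
Proof. exact: rmorphM. Qed.
Lemma to_Seq1 : to_Seq 1 = 1.
Proof. exact: rmorph1. Qed.

Lemma repr_Seq (s : Seq) : to_Seq (repr s) = s.
Proof. exact: reprK. Qed.

Definition Seq_shift (s : Seq) : Seq := to_Seq (fun i => repr s i.+1).

Lemma Seq_shiftE f : Seq_shift (to_Seq f) = to_Seq (fun i => f i.+1).
Proof.
have /to_SeqP[N fN] := repr_Seq (to_Seq f).
by apply/to_SeqP; exists N => i Ni; apply/fN/leqW.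
Qed.

Lemma Seq_shift_is_zmod_morphism : zmod_morphism Seq_shift.
Proof.
move=> s t; rewrite -(repr_Seq s) -(repr_Seq t) -to_SeqB !Seq_shiftE.
by rewrite -to_SeqB.
Qed.

Lemma Seq_shift_is_monoid_morphism : monoid_morphism Seq_shift.
Proof.
split=> [|s t]; first by rewrite -to_Seq1 Seq_shiftE.
rewrite -(repr_Seq s) -(repr_Seq t) -to_SeqM !Seq_shiftE.
by rewrite -to_SeqM.
Qed.

HB.instance Definition _ :=
  GRing.isZmodMorphism.Build Seq Seq Seq_shift Seq_shift_is_zmod_morphism.
HB.instance Definition _ :=
  GRing.isMonoidMorphism.Build Seq Seq Seq_shift Seq_shift_is_monoid_morphism.

(* The proof of characteristic zero is an argument because the map is a ring
   morphism only when the points 0, 1, 2, ... are distinct in k. *)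
Definition frac_to_Seq (_ : [pchar k] =i pred0) (h : {fraction {poly k}}) : Seq :=
  to_Seq (fun i => frac_eval h i%:R).

Section CharacteristicZero.
Hypothesis k0 : [pchar k] =i pred0.

Lemma eventually_nonroot (p : {poly k}) : p != 0 ->
  exists N, forall i, (N <= i)%N -> p.[i%:R] != 0.
Proof.
have [m] := ubnP (size p); elim: m p => // m IH p sp p0.
have [[j pj]|nr] := pselect (exists j : nat, root p j%:R); last first.
  by exists 0%N => i _; apply/negP => pi0; apply: nr; exists i.
have /factor_theorem[q qE] := pj.
have q0 : q != 0 by apply: contraNneq p0 => q0; rewrite qE q0 mul0r.
have [||N qN] := IH q; rewrite ?q0 //.
  by move: sp; rewrite qE size_Mmonic ?monicXsubC // size_XsubC addn2.
exists (maxn N j.+1) => i; rewrite geq_max => /andP[Ni ji].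
rewrite qE hornerM mulf_neq0 ?qN // hornerXsubC -natrB 1?ltnW //.
by move/pcharf0P: k0 => ->; rewrite -lt0n subn_gt0.
Qed.

Lemma frac_to_SeqE (h : {fraction {poly k}}) (p q : {poly k}) : q != 0 ->
  h = p%:F / q%:F -> frac_to_Seq k0 h = to_Seq (fun i => p.[i%:R] / q.[i%:R]).
Proof.
move=> /eventually_nonroot[N qN] hE; apply/to_SeqP; exists N => i Ni.
by case: (frac_evalE (qN i Ni) hE).
Qed.

Lemma frac_to_Seq_is_zmod_morphism : zmod_morphism (frac_to_Seq k0).
Proof.
move=> h g.
rewrite (frac_to_SeqE _ (fracB h g)) ?mulf_neq0 ?frac_den_neq0 // -to_SeqB.
have [N hN] := eventually_nonroot (frac_den_neq0 h).
have [M gM] := eventually_nonroot (frac_den_neq0 g).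
apply/to_SeqP; exists (maxn N M) => i; rewrite geq_max => /andP[Ni Mi].
by rewrite hornerD hornerN !hornerM -mulNr -addf_div ?hN ?gM // mulNr.
Qed.

Lemma frac_to_Seq_is_monoid_morphism : monoid_morphism (frac_to_Seq k0).
Proof.
split=> [|h g].
  rewrite (frac_to_SeqE _ (frac1 k)) ?oner_neq0 // -to_Seq1.
  by apply/to_SeqP; exists 0%N => i _; rewrite hornerC divr1.
rewrite (frac_to_SeqE _ (fracM h g)) ?mulf_neq0 ?frac_den_neq0 // -to_SeqM.
apply/to_SeqP; exists 0%N => i _.
by rewrite -[RHS]/(_ / _ * (_ / _)) !hornerM mulf_div.
Qed.

HB.instance Definition _ := GRing.isZmodMorphism.Build
  {fraction {poly k}} Seq (frac_to_Seq k0) frac_to_Seq_is_zmod_morphism.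
HB.instance Definition _ := GRing.isMonoidMorphism.Build
  {fraction {poly k}} Seq (frac_to_Seq k0) frac_to_Seq_is_monoid_morphism.

Lemma frac_to_Seq_shift h :
  Seq_shift (frac_to_Seq k0 h) = frac_to_Seq k0 (frac_shift h).
Proof.
rewrite Seq_shiftE (frac_to_SeqE _ (erefl (frac_shift h))); last first.
  exact/comp_neq0/frac_den_neq0.
apply/to_SeqP; exists 0%N => i _.
by rewrite !horner_comp hornerD hornerX hornerC natr1.
Qed.

End CharacteristicZero.
End Sequences.

Section DifferenceAlgebra.

(* The sigma-ring L is the pair of the ring L and its endomorphism sigma.  The third
   clause is the decomposition L = e_0 L + ... + e_(l-1) L, as a direct sum. *)
Definition pseudo_field (L : comNzRingType) (sigma : {rmorphism L -> L}) : Prop :=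
  exists (l : nat) (e : 'I_l -> L),
  [/\ (0 < l)%N,
      (forall i, e i * e i = e i) /\ (forall i j, i != j -> e i * e j = 0),
      (forall x, exists y : 'I_l -> L, x = \sum_i e i * y i) /\
      (forall y : 'I_l -> L, \sum_i e i * y i = 0 -> forall i, e i * y i = 0),
      forall i, sigma (e i) = e (ordS i) &
      forall i, e i != 0 /\
        forall x, e i * x != 0 -> exists y, (e i * x) * (e i * y) = e i].

Definition total_ring_of_fractions (L : comNzRingType) (R : L -> Prop) : Prop :=
  let regular b := R b /\ (forall c, R c -> b * c = 0 -> c = 0) in
  (forall b, regular b -> exists c, b * c = 1) /\
  (forall x, exists a b, [/\ R a, regular b & b * x = a]).

(* The subring K[Y_ij] of L. *)
Definition adjoin_entries (K : fieldType) (L : comNzRingType)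
    (iota : {rmorphism K -> L}) (n : nat) (Y : 'M[L]_n) (x : L) : Prop :=
  exists p : {mpoly K[n * n]}, x = mmap iota (fun i => mxvec Y ord0 i) p.

Definition picard_vessiot (K : fieldType) (sigmaK : {rmorphism K -> K})
    (L : comNzRingType) (sigma : {rmorphism L -> L}) (iota : {rmorphism K -> L})
    (n : nat) (A : 'M[K]_n) : Prop :=
  [/\ pseudo_field sigma,
      forall a, sigma (iota a) = iota (sigmaK a),
      exists Y : 'M[L]_n,
        [/\ exists Z : 'M[L]_n, Y *m Z = 1%:M /\ Z *m Y = 1%:M,
            map_mx sigma Y = map_mx iota A *m Y &
            total_ring_of_fractions (adjoin_entries iota Y)] &
      forall x, sigma x = x <-> exists2 a, sigmaK a = a & x = iota a].

Section SigmaSubalgebras.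
Variables (K : fieldType) (R : comNzRingType).
Variables (sigma : {rmorphism R -> R}) (iota : {rmorphism K -> R}).

Record sigma_subalgebra := SigmaSubalgebra {
  subalg_pred : {pred R};
  subalg_subring : subring_closed subalg_pred;
  subalg_const : forall a, iota a \in subalg_pred;
  subalg_sigma : {in subalg_pred, forall x, sigma x \in subalg_pred} }.

Variable S : sigma_subalgebra.

HB.instance Definition _ :=
  GRing.isSubringClosed.Build R (subalg_pred S) (subalg_subring S).

Definition subalg_type := {x : R | x \in subalg_pred S}.
HB.instance Definition _ := SubChoice.on subalg_type.
HB.instance Definition _ := [SubChoice_isSubComNzRing of subalg_type by <:].

Definition sub_sigma (x : subalg_type) : subalg_type :=
  exist _ (sigma (val x)) (subalg_sigma (valP x)).

Definition sub_iota (a : K) : subalg_type := exist _ (iota a) (subalg_const S a).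

Lemma sub_sigma_is_zmod_morphism : zmod_morphism sub_sigma.
Proof. by move=> x y; apply: val_inj; rewrite rmorphB /= rmorphB. Qed.
Lemma sub_sigma_is_monoid_morphism : monoid_morphism sub_sigma.
Proof.
split=> [|x y]; apply: val_inj; first by rewrite /= !rmorph1.
by rewrite rmorphM /= rmorphM.
Qed.
HB.instance Definition _ := GRing.isZmodMorphism.Build
  subalg_type subalg_type sub_sigma sub_sigma_is_zmod_morphism.
HB.instance Definition _ := GRing.isMonoidMorphism.Build
  subalg_type subalg_type sub_sigma sub_sigma_is_monoid_morphism.

Lemma sub_iota_is_zmod_morphism : zmod_morphism sub_iota.
Proof. by move=> x y; apply: val_inj; rewrite rmorphB /= rmorphB. Qed.
Lemma sub_iota_is_monoid_morphism : monoid_morphism sub_iota.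
Proof.
split=> [|x y]; apply: val_inj; first by rewrite /= !rmorph1.
by rewrite rmorphM /= rmorphM.
Qed.
HB.instance Definition _ := GRing.isZmodMorphism.Build
  K subalg_type sub_iota sub_iota_is_zmod_morphism.
HB.instance Definition _ := GRing.isMonoidMorphism.Build
  K subalg_type sub_iota sub_iota_is_monoid_morphism.

End SigmaSubalgebras.
End DifferenceAlgebra.

Section RationalMap.
Variables (k : fieldType) (n : nat) (A : 'M[{fraction {poly k}}]_n).

(* The k-points (b, B) of X = A^1 x GL_n. *)
Definition in_X (x : k * 'M[k]_n) : bool := x.2 \in unitmx.

Definition sigma_dom (x : k * 'M[k]_n) : Prop :=
  (forall i j, ~~ has_pole (A i j) x.1) /\ frac_eval (\det A) x.1 != 0.

(* The values of the rational map sigma; meaningful only on sigma_dom. *)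
Definition sigma_map (x : k * 'M[k]_n) : k * 'M[k]_n :=
  (x.1 + 1, map_mx (fun h => frac_eval h x.1) A *m x.2).

Definition orbit_defined (x : k * 'M[k]_n) : Prop :=
  forall i : nat, sigma_dom (iter i sigma_map x).

(* Elements of the coordinate ring k[z, Z_ij, 1/det(Z)] are given as polynomials
   in z, the Z_ij and 1/det(Z), in this order. *)
Definition coord_vec (x : k * 'M[k]_n) : 'rV[k]_(1 + n * n + 1) :=
  row_mx (row_mx x.1%:M (mxvec x.2)) (\det x.2)^-1%:M.

Definition coord_eval (P : {mpoly k[1 + n * n + 1]}) (x : k * 'M[k]_n) : k :=
  P.@[fun i => coord_vec x ord0 i].

Definition zero_locus (E : seq {mpoly k[1 + n * n + 1]}) (x : k * 'M[k]_n) : Prop :=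
  in_X x /\ {in E, forall P, coord_eval P x = 0}.

End RationalMap.

(* Main.v *)
Require Import Defs.
From mathcomp Require Import all_boot all_order all_algebra fraction mpoly.
From HB Require Import structures.
From mathcomp Require Import perm boolp functions.
From mathcomp Require Import zify ring.

(* (i) => (ii): a solution f of a recurrence is read off the first column of an orbit
   of the companion matrix.

   (ii) => (iii): let Y be a fundamental matrix with entries in Seq, and R = k(z)[Y_ij].
   The elements of R satisfy linear recurrences, so by (ii) each of them has an
   ultimately periodic support.  As R is Noetherian, it has an element x <> 0 whose
   annihilator is prime.  Comparing x with its shifts shows that the support of x is
   ultimately a single residue class modulo some m, and that an element of R not
   annihilated by a shift of x vanishes nowhere on the corresponding class.  Hence the
   regular elements of R are units of Seq, the indicators of the residue classes modulo
   m are fractions of elements of R, and the total ring of fractions of R is a pseudo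
   field inside Seq.  Its constants are the constant sequences.

   (iii) => (i): after a translation of z, the matrices along an orbit form a second
   fundamental matrix, hence differ from the one of the Picard-Vessiot extension L by a
   constant matrix.  So the values of a regular function along the orbit form an element
   of L, and an element of a pseudo field with l components has an ultimately l-periodic
   support. *)

Set Implicit Arguments.
Unset Strict Implicit.
Unset Printing Implicit Defensive.
Import Order.TTheory GRing.Theory.

Local Open Scope ring_scope.
Local Notation "x %:F" := (FracField.tofrac x).

(** * Ultimately periodic sets *)

Definition ultimately (P : nat -> Prop) : Prop :=
  exists N : nat, forall i, (N <= i)%N -> P i.

Lemma ultimatelyT (P : nat -> Prop) : (forall i, P i) -> ultimately P.
Proof. by move=> PT; exists 0%N. Qed.

Lemma ultimatelyI (P Q : nat -> Prop) :
  ultimately P -> ultimately Q -> ultimately (fun i => P i /\ Q i).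
Proof.
move=> [N PN] [M QM]; exists (maxn N M) => i; rewrite geq_max => /andP[Ni Mi].
by split; [apply: PN | apply: QM].
Qed.

Lemma ultimatelyW (P Q : nat -> Prop) :
  (forall i, P i -> Q i) -> ultimately P -> ultimately Q.
Proof. by move=> PQ [N PN]; exists N => i /PN/PQ. Qed.

Lemma ultimatelyW2 (P Q S : nat -> Prop) : (forall i, P i -> Q i -> S i) ->
  ultimately P -> ultimately Q -> ultimately S.
Proof. by move=> PQS uP uQ; apply: ultimatelyW (ultimatelyI uP uQ) => i []; apply: PQS. Qed.

Lemma ultimately_addn (P : nat -> Prop) (d : nat) :
  ultimately P -> ultimately (fun i => P (i + d)%N).
Proof. by move=> [N PN]; exists N => i Ni; apply/PN/(leq_trans Ni)/leq_addr. Qed.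

Lemma ultimately_subn (P : nat -> Prop) (d : nat) :
  ultimately (fun i => P (i + d)%N) -> ultimately P.
Proof.
move=> [N PN]; exists (N + d)%N => i Nd; rewrite -(@subnK d i); last by lia.
by apply: PN; lia.
Qed.

Lemma ultimately_forall (I : finType) (P : I -> nat -> Prop) :
  (forall a, ultimately (P a)) -> ultimately (fun i => forall a, P a i).
Proof.
move=> /choice[N PN]; exists (\max_a N a)%N => i Ni a.
by apply: PN; apply: leq_trans Ni; exact: leq_bigmax.
Qed.

Lemma frequently (P : nat -> Prop) : ~ ultimately (fun t => ~ P t) ->
  forall N, exists2 t, (N <= t)%N & P t.
Proof.
move=> nP N; apply: contrapT => noP; apply: nP; exists N => t Nt Pt.
by apply: noP; exists t.
Qed.

Definition ultimately_periodic (P : nat -> Prop) : Prop :=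
  exists2 l : nat, (0 < l)%N & ultimately (fun i => P (i + l)%N <-> P i).

Lemma periodicMn (P : nat -> Prop) (l N : nat) :
  (forall i, (N <= i)%N -> P (i + l)%N <-> P i) ->
  forall m i, (N <= i)%N -> P (i + m * l)%N <-> P i.
Proof.
move=> Pl; elim=> [|m IH] i Ni; first by rewrite mul0n addn0.
by rewrite mulSnr addnA Pl ?IH //; apply: leq_trans Ni _; rewrite leq_addr.
Qed.

Lemma ultimately_periodic_addn (P : nat -> Prop) (d : nat) :
  ultimately_periodic (fun i => P (i + d)%N) -> ultimately_periodic P.
Proof.
move=> [l l0 Pl]; exists l => //; apply: (@ultimately_subn _ d).
by apply: ultimatelyW Pl => i; rewrite addnAC.
Qed.

Lemma ultimately_iff (P Q : nat -> Prop) : ultimately (fun i => P i <-> Q i) ->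
  ultimately_periodic P -> ultimately_periodic Q.
Proof.
move=> PQ [l l0 Pl]; exists l => //.
by apply: ultimatelyW2 Pl (ultimatelyI PQ (ultimately_addn l PQ)) => i Pli [<- <-].
Qed.

(** Passing to ultimate periodicity turns closure under intersections, shifts and finite changes
    into simple arithmetic on periods; all later arguments use this form. *)
Lemma finite_union_of_APP (P : nat -> Prop) :
  finite_union_of_AP P <-> ultimately_periodic P.
Proof.
split.
  move=> [s]; elim: s P => [|[j l] s IH] P Ps.
    by exists 1%N => //; exists 0%N => i _; split=> /Ps[].
  have [l' l'0 [N' QN]] :=
    IH (fun i => exists2 jl, jl \in s & exists m, i = (jl.1 + m * jl.2)%N)
       (fun i => iff_refl _).
  (* A progression with [l = 0] is a singleton, hence empty beyond [j], and the period 1 fits it. *)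
  exists (l' * (if l == 0 then 1 else l))%N.
    by rewrite muln_gt0 l'0 /=; case: eqP; lia.
  exists (maxn N' j.+1) => i; rewrite geq_max => /andP[Ni ji].
  have split_cons i' : P i' <-> (exists m, i' = j + m * l)%N \/
      (exists2 jl, jl \in s & exists m, i' = jl.1 + m * jl.2)%N.
    rewrite Ps; split=> [[jl]|].
      by rewrite inE => /orP[/eqP->|jls] ?; [left|right; exists jl].
    move=> [?|[jl jls ?]]; first by exists (j, l); rewrite ?mem_head.
    by exists jl; rewrite // inE jls orbT.
  rewrite !split_cons mulnC (periodicMn QN) //.
  suff -> : (exists m, i + (if l == 0 then 1 else l) * l' = j + m * l)%N <->
            (exists m, i = j + m * l)%N by [].
  case: eqP => [->|/eqP l0]; first by split=> -[m]; lia.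
  split=> -[m mE]; last by exists (m + l')%N; rewrite mE mulnDl; lia.
  by exists (m - l')%N; rewrite mulnBl; lia.
move=> [l l0 [N PN]].
(* Members below [N] give singletons; members of the first full period from [N] on give progressions
   of difference [l]. *)
exists ([seq (i, 0%N) | i <- iota 0 N & `[< P i >]] ++
        [seq (i, l) | i <- iota N l & `[< P i >]]) => i; split=> [Pi|].
  have [iN|Ni] := ltnP i N.
    exists (i, 0%N); last by exists 0%N; rewrite addn0.
    rewrite mem_cat; apply/orP; left; apply/mapP; exists i => //.
    by rewrite mem_filter asboolT //= mem_iota.
  exists ((N + (i - N) %% l)%N, l); last first.
    by exists ((i - N) %/ l)%N => /=; have := divn_eq (i - N) l; lia.
  rewrite mem_cat; apply/orP; right; apply/mapP; exists (N + (i - N) %% l)%N => //.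
  rewrite mem_filter mem_iota ltn_add2l ltn_mod l0 leq_addr !andbT.
  apply/asboolP; rewrite -(periodicMn PN ((i - N) %/ l)%N); last exact: leq_addr.
  by congr P: Pi; have := divn_eq (i - N) l; lia.
move=> [jl]; rewrite mem_cat => /orP[] /mapP[j].
  by rewrite mem_filter => /andP[/asboolP Pj _] -> [m ->] /=; rewrite muln0 addn0.
rewrite mem_filter mem_iota => /andP[/asboolP Pj /andP[Nj _]] -> [m ->] /=.
by rewrite (periodicMn PN).
Qed.

(** * Sequences modulo finitely many terms *)

Section SequenceClasses.
Variable k : fieldType.
Implicit Types (f g : nat -> k) (s t : Seq k).

HB.instance Definition _ :=
  GRing.isZmodMorphism.Build (nat -> k) (Seq k) (@to_Seq k) (@to_SeqB k).
HB.instance Definition _ := GRing.isMonoidMorphism.Build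
  (nat -> k) (Seq k) (@to_Seq k) (@to_Seq1 k, @to_SeqM k).

Lemma to_Seq_eq0 f : to_Seq f = 0 <-> ultimately (fun i => f i = 0).
Proof. by rewrite -(rmorph0 (@to_Seq k)); apply: to_SeqP. Qed.

Lemma Seq_eqP s t : s = t <-> ultimately (fun i => repr s i = repr t i).
Proof. by rewrite -{1}(repr_Seq s) -{1}(repr_Seq t); apply: to_SeqP. Qed.

Lemma repr_to_Seq f : ultimately (fun i => repr (to_Seq f) i = f i).
Proof. by apply/to_SeqP; rewrite repr_Seq. Qed.

Lemma repr_SeqM s t : ultimately (fun i => repr (s * t) i = repr s i * repr t i).
Proof.
apply/to_SeqP; rewrite repr_Seq -{1}(repr_Seq s) -{1}(repr_Seq t).
by rewrite -(rmorphM (@to_Seq k)).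
Qed.

Lemma repr_Seq1 : ultimately (fun i => repr (1 : Seq k) i = 1).
Proof. by apply/to_SeqP; rewrite repr_Seq -(rmorph1 (@to_Seq k)). Qed.

Lemma repr_iter_shift (d : nat) s :
  ultimately (fun i => repr (iter d (@Seq_shift k) s) i = repr s (i + d)%N).
Proof.
elim: d => [|d IH]; first by apply: ultimatelyT => i; rewrite addn0.
apply: (ultimatelyW2 _ (repr_to_Seq (fun i => repr (iter d (@Seq_shift k) s) i.+1))
  (ultimately_addn 1 IH)) => i.
by rewrite addn1 addSnnS => <-.
Qed.

Lemma Seq_eq0P s : s = 0 <-> ultimately (fun i => repr s i = 0).
Proof. by rewrite -{1}(repr_Seq s) to_Seq_eq0. Qed.

Lemma Seq_unitP s : (exists c, s * c = 1) <-> ultimately (fun i => repr s i <> 0).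
Proof.
split=> [[c sc1]|s0].
  have := repr_Seq1; rewrite -sc1.
  apply: ultimatelyW2 (repr_SeqM s c) => i -> sc si0.
  by move/eqP: sc; rewrite si0 mul0r eq_sym oner_eq0.
exists (to_Seq (fun i => (repr s i)^-1)); rewrite -{1}(repr_Seq s) -rmorphM.
rewrite -(rmorph1 (@to_Seq k)); apply/to_SeqP.
by apply: ultimatelyW s0 => i /eqP si0; rewrite -[LHS]/(_ * _) divff.
Qed.

(** The constants of [Seq k] are thus those of [k], which every [k(z)]-subalgebra contains. *)
Lemma Seq_shift_const s :
  Seq_shift s = s -> exists c : k, s = to_Seq (fun=> c).
Proof.
move=> /Seq_eqP/ultimatelyI/(_ (repr_iter_shift 1 s)) [N sN].
exists (repr s N); rewrite -[LHS]repr_Seq; apply/to_SeqP; exists N => i Ni.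
rewrite -(subnK Ni) addnC; elim: (i - N)%N => [|d IH]; first by rewrite addn0.
have [/= -> ] := sN (N + d)%N (leq_addr _ _).
by rewrite addn1 addnS IH => <-.
Qed.

Definition to_Seq_mx m n (F : nat -> 'M[k]_(m, n)) : 'M[Seq k]_(m, n) :=
  \matrix_(i, j) to_Seq (fun a => F a i j).

Section ToSeqMatrix.
Variables m n p : nat.

Lemma to_Seq_mxP (F G : nat -> 'M[k]_(m, n)) :
  to_Seq_mx F = to_Seq_mx G <-> ultimately (fun a => F a = G a).
Proof.
split=> [FG|FG]; last first.
  apply/matrixP => i j; rewrite !mxE; apply/to_SeqP.
  by apply: ultimatelyW FG => a ->.
have FGij (ij : 'I_m * 'I_n) : ultimately (fun a => F a ij.1 ij.2 = G a ij.1 ij.2).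
  by apply/to_SeqP; move/matrixP/(_ ij.1 ij.2): FG; rewrite !mxE.
apply: ultimatelyW (ultimately_forall FGij) => a FGa.
by apply/matrixP => i j; apply: (FGa (i, j)).
Qed.

Lemma to_Seq_mxM (F : nat -> 'M[k]_(m, n)) (G : nat -> 'M[k]_(n, p)) :
  to_Seq_mx (fun a => F a *m G a) = to_Seq_mx F *m to_Seq_mx G.
Proof.
apply/matrixP => i j; rewrite !mxE; under [RHS]eq_bigr do rewrite !mxE -rmorphM.
rewrite -rmorph_sum; congr to_Seq; apply/funext => a.
by rewrite fct_sumE mxE.
Qed.

Lemma to_Seq_mx_shift (F : nat -> 'M[k]_(m, n)) :
  map_mx (@Seq_shift k) (to_Seq_mx F) = to_Seq_mx (fun a => F a.+1).
Proof. by apply/matrixP => i j; rewrite !mxE Seq_shiftE. Qed.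

End ToSeqMatrix.

Lemma to_Seq_mx1 n : to_Seq_mx (fun=> 1%:M : 'M[k]_n) = 1%:M.
Proof.
apply/matrixP => i j; rewrite !mxE.
by case: (i == j); [apply: rmorph1 | apply: rmorph0].
Qed.

Lemma to_Seq_mx_det n (F : nat -> 'M[k]_n) :
  \det (to_Seq_mx F) = to_Seq (fun a => \det (F a)).
Proof.
have -> : (fun a => \det (F a)) =
    \sum_(s : 'S_n) (-1) ^+ s * \prod_i (fun a => F a i (s i)).
  apply/funext => a; rewrite fct_sumE; apply: eq_bigr => s _.
  rewrite -[RHS]/((((-1) ^+ s : nat -> k) a) * _) fct_prodE.
  by congr (_ * _); case: (odd_perm s).
rewrite rmorph_sum; apply: eq_bigr => s _; rewrite rmorphM rmorph_sign rmorph_prod.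
by under eq_bigr do rewrite mxE.
Qed.

End SequenceClasses.

(** * Evaluation and translation of rational functions *)

Section RationalFunctionsAsSequences.
Variable k : fieldType.
Implicit Types (h g : {fraction {poly k}}) (b : k).

Lemma frac_eval_polyC (c a : k) : frac_eval (c%:P%:F) a = c.
Proof.
have [||_ ->] := @frac_evalE _ (c%:P%:F) c%:P 1 a.
- by rewrite hornerC oner_neq0.
- by rewrite tofrac1 divr1.
- by rewrite !hornerC divr1.
Qed.

(** An orbit starting over the point [b] evaluates rational functions at [b + i], whereas
    [frac_to_Seq] evaluates at [i]; this substitution reconciles the two. *)
Definition frac_translate b h : {fraction {poly k}} :=
  (frac_num h \Po ('X + b%:P))%:F / (frac_den h \Po ('X + b%:P))%:F.

Lemma comp_XaddC_neq0 b (p : {poly k}) : p != 0 -> p \Po ('X + b%:P) != 0.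
Proof. by move=> p0; rewrite comp_poly2_eq0 // size_XaddC. Qed.

Lemma frac_translateE b h (p q : {poly k}) : q != 0 -> h = p%:F / q%:F ->
  frac_translate b h = (p \Po ('X + b%:P))%:F / (q \Po ('X + b%:P))%:F.
Proof.
move=> q0 hE; apply/eqP; rewrite /frac_translate eqr_div; last 2 first.
- exact/tofrac_neq0/comp_XaddC_neq0/frac_den_neq0.
- exact/tofrac_neq0/comp_XaddC_neq0.
by rewrite -!tofracM tofrac_eq -!comp_polyM (frac_cross q0 hE).
Qed.

Lemma frac_translate_is_zmod_morphism b : zmod_morphism (frac_translate b).
Proof.
move=> h g; rewrite (frac_translateE b _ (fracB h g)) ?mulf_neq0 ?frac_den_neq0 //.
rewrite comp_polyB !comp_polyM tofracB !tofracM -mulNr.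
by rewrite -addf_div ?mulNr // tofrac_neq0 // comp_XaddC_neq0 // frac_den_neq0.
Qed.

Lemma frac_translate_is_monoid_morphism b : monoid_morphism (frac_translate b).
Proof.
split=> [|h g].
  by rewrite (frac_translateE b _ (frac1 k)) ?oner_neq0 // rmorph1 tofrac1 divr1.
rewrite (frac_translateE b _ (fracM h g)) ?mulf_neq0 ?frac_den_neq0 //.
by rewrite !comp_polyM !tofracM mulf_div.
Qed.

HB.instance Definition _ b := GRing.isZmodMorphism.Build
  {fraction {poly k}} {fraction {poly k}} (frac_translate b)
  (frac_translate_is_zmod_morphism b).
HB.instance Definition _ b := GRing.isMonoidMorphism.Build
  {fraction {poly k}} {fraction {poly k}} (frac_translate b)
  (frac_translate_is_monoid_morphism b).

Hypothesis k0 : [pchar k] =i pred0.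

Lemma frac_translate_to_Seq b h :
  frac_to_Seq k0 (frac_translate b h) = to_Seq (fun i => frac_eval h (b + i%:R)).
Proof.
rewrite (frac_to_SeqE k0 _ (erefl (frac_translate b h))); last first.
  exact/comp_XaddC_neq0/frac_den_neq0.
apply/to_SeqP; exists 0%N => i _.
by rewrite !horner_comp hornerD hornerX hornerC addrC.
Qed.

Lemma frac_to_Seq_poly (p : {poly k}) :
  frac_to_Seq k0 (p%:F) = to_Seq (fun i => p.[i%:R]).
Proof.
rewrite (@frac_to_SeqE _ k0 _ p 1) ?oner_neq0 ?tofrac1 ?divr1 //.
by apply/to_SeqP; exists 0%N => i _; rewrite hornerC divr1.
Qed.

Lemma frac_to_Seq_polyC (c : k) : frac_to_Seq k0 (c%:P%:F) = to_Seq (fun=> c).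
Proof.
by rewrite frac_to_Seq_poly; congr to_Seq; apply/funext => i; rewrite hornerC.
Qed.

Lemma map_frac_to_Seq m n (A : 'M[{fraction {poly k}}]_(m, n)) :
  map_mx (frac_to_Seq k0) A =
  to_Seq_mx (fun i => map_mx (fun h => frac_eval h i%:R) A).
Proof.
apply/matrixP => i j; rewrite !mxE; congr to_Seq; apply/funext => a.
by rewrite mxE.
Qed.

(** At poles, [frac_eval] does not respect products, so the identity between [A] and its inverse is
    transported by the ring morphism [frac_to_Seq], after which it holds for all large [i]. *)
Lemma ultimately_frac_eval_unitmx n (A : 'M[{fraction {poly k}}]_n) :
  A \in unitmx ->
  ultimately (fun i => map_mx (fun h => frac_eval h i%:R) A \in unitmx).
Proof.
move=> Au; have : map_mx (frac_to_Seq k0) A *m map_mx (frac_to_Seq k0) (invmx A) = 1%:M.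
  by rewrite -map_mxM mulmxV // map_mx1.
rewrite !map_frac_to_Seq -to_Seq_mxM -to_Seq_mx1 => /to_Seq_mxP.
by apply: ultimatelyW => i /mulmx1_unit[].
Qed.

Lemma ultimately_no_pole h : ultimately (fun i => ~~ has_pole h i%:R).
Proof.
by have := eventually_nonroot k0 (frac_den_neq0 h).
Qed.

Lemma ultimately_frac_eval_neq0 h :
  h != 0 -> ultimately (fun i => frac_eval h i%:R != 0).
Proof.
move=> hn0; have : (exists c, frac_to_Seq k0 h * c = 1).
  by exists (frac_to_Seq k0 h^-1); rewrite -rmorphM divff // rmorph1.
move=> /Seq_unitP; apply: ultimatelyW2 (repr_to_Seq (fun i => frac_eval h i%:R)).
by move=> i -> /eqP.
Qed.

End RationalFunctionsAsSequences.

(** * Prime annihilators in finitely generated algebras *)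

Section Noetherian.

Lemma nondecreasing_subsequence (f : nat -> nat) :
  exists g : nat -> nat, forall i j, (i < j)%N -> (g i < g j)%N /\ (f (g i) <= f (g j))%N.
Proof.
(* [a N] is a place where [f] attains its minimum on the tail from [N]; iterating from the successor
   of the last choice gives the subsequence. *)
have /choice[a aP] N : exists a, (N <= a)%N /\ forall i, (N <= i)%N -> (f a <= f i)%N.
  have /ex_minnP[v /asboolP[a Na <-] vmin] : exists v, `[< exists2 a, (N <= a)%N & f a = v >].
    by exists (f N); apply/asboolP; exists N.
  by exists a; split=> // i Ni; apply: vmin; apply/asboolP; exists i.
pose g := fix g j := if j is j'.+1 then a (g j').+1 else a 0%N.
have gS j : (g j < g j.+1)%N by have [] := aP (g j).+1.
have gfmin j i : (g j <= i)%N -> (f (g j) <= f i)%N.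
  by case: j => [|j] gi; apply: (aP _).2 => //; apply: leq_trans gi; apply: (aP _).1.
exists g => i j ij; have gij := homo_ltn ltn_trans gS ij.
by split=> //; apply/gfmin/ltnW.
Qed.

(** Dickson's lemma: subsequences are extracted one variable at a time, until every exponent is
    nondecreasing. *)
Lemma dickson n (u : nat -> 'X_{1..n}) :
  exists i j, (i < j)%N /\ (u i <= u j)%MM.
Proof.
suff /(_ n)[g gP] m : exists g : nat -> nat, forall i j, (i < j)%N ->
    (g i < g j)%N /\ forall c : 'I_n, (c < m)%N -> (u (g i) c <= u (g j) c)%N.
  have [g01 ug] := gP 0%N 1%N isT.
  by exists (g 0%N), (g 1%N); split=> //; apply/mnm_lepP => c; apply: ug.
elim: m => [|m [g gP]]; first by exists id => i j ->.
have [mn|nm] := ltnP m n; last first.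
  exists g => i j /gP[gij ug]; split=> // c cm.
  by apply: ug; apply: leq_trans nm.
have [h hP] := nondecreasing_subsequence (fun i => u (g i) (Ordinal mn)).
exists (g \o h) => i j /hP[/gP[gij ug] uh]; split=> //= c.
rewrite ltnS leq_eqVlt => /orP[/eqP cm|]; last exact: ug.
by rewrite (_ : c = Ordinal mn) //; apply: val_inj.
Qed.

Variables (K : fieldType) (n : nat).
Implicit Types p q r : {mpoly K[n]}.

(** One step of polynomial division: the multiple of [q] is chosen to have the same leading term as
    [p]. *)
Lemma mlead_cancel p q : q != 0 -> (mlead q <= mlead p)%MM ->
  let s := (mleadc p / mleadc q)%:MP * 'X_[mlead p - mlead q] * q in
  p - s = 0 \/ (mlead (p - s) < mlead p)%O.
Proof.
move=> q0 qp s; have [->|r0] := eqVneq (p - s) 0; [by left | right].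
have lq : mleadc q != 0 by rewrite mleadc_eq0.
have sp : s@_(mlead p) = mleadc p.
  have eqX : (q * 'X_[mlead p - mlead q])@_(mlead p) = mleadc q.
    by have := mcoeffMX q (mlead p - mlead q) (mlead q); rewrite submK.
  by rewrite /s -mulrA mcoeffCM [_ * q]mulrC eqX divfK.
have ls : (mlead s <= mlead p)%O.
  apply: le_trans (mleadM_le _ _) _.
  rewrite -[X in (_ <= X)%O](submK qp); apply: lem_add => //.
  rewrite mul_mpolyC; apply: le_trans (mleadZ_le _ _) _.
  by rewrite mleadXm.
rewrite lt_neqAle; apply/andP; split; last first.
  apply: le_trans (mleadB_le _ _) _.
  by rewrite leUx ls lexx.
apply: contraNneq r0 => lr; rewrite -mleadc_eq0 lr.
by rewrite mcoeffB sp subrr.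
Qed.

Definition mpoly_ideal (I : {mpoly K[n]} -> Prop) : Prop :=
  [/\ I 0, forall p q, I p -> I q -> I (p - q) & forall p q, I q -> I (p * q)].

(** Hilbert's basis theorem as a chain condition. A chain growing at every step would yield a
    sequence of leading monomials, none divisible by an earlier one, against Dickson's lemma. *)
Lemma mpoly_ideal_chain (I : nat -> {mpoly K[n]} -> Prop) :
  (forall t, mpoly_ideal (I t)) -> (forall t p, I t p -> I t.+1 p) ->
  exists t, forall p, I t.+1 p -> I t p.
Proof.
move=> idI Isub; apply: contrapT => noT.
have lead_new t : exists p, [/\ I t.+1 p, ~ I t p &
    forall q, I t q -> q != 0 -> ~~ (mlead q <= mlead p)%MM].
  have [p [pI pnI]] : exists p, I t.+1 p /\ ~ I t p.
    apply: contrapT => no; apply: noT; exists t => p pI.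
    by apply: contrapT => pnI; apply: no; exists p.
  move: {2}(mlead p) (erefl (mlead p)) => m; move: p pI pnI.
  (* A division step by an element of [I t] keeps [p] inside [I t.+1] and outside [I t] while
     lowering its leading monomial, so the process stops at a reduced polynomial. *)
  elim/(well_founded_ind (@ltom_wf n)): m => m IH p pI pnI pm.
  have [[q [qI q0 qp]]|nq] :=
    pselect (exists q, [/\ I t q, q != 0 & (mlead q <= mlead p)%MM]); last first.
    exists p; split=> // q qI q0; apply/negP => qp.
    by apply: nq; exists q.
  have := mlead_cancel q0 qp; set s := _ * q; move=> /= rP.
  have [It0 ItB ItM] := idI t; have [_ IB _] := idI t.+1.
  have sI : I t s by apply: ItM.
  have rI : I t.+1 (p - s) by apply: IB pI _; apply: Isub.
  have rnI : ~ I t (p - s).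
    move=> rIt; apply: pnI.
    by have := ItB _ _ rIt (ItB _ _ It0 sI); rewrite sub0r opprK subrK.
  case: rP => [r0|rlt]; last by apply: (IH _ _ _ rI rnI erefl); rewrite -pm.
  by case: rnI; rewrite r0.
have [p pP] := choice lead_new.
(* As [i < j], the polynomial [p i] lies in [I j], and [p j] was chosen reduced with respect to
   [I j]. *)
have [i [j [ij]]] := dickson (fun t => mlead (p t)); apply/negP.
have [piI pinI _] := pP i; have [_ _ pjmin] := pP j; apply: pjmin.
  rewrite -(subnK ij); elim: (j - i.+1)%N => [|d IHd] //.
  by rewrite addSn; apply: Isub.
by apply: contra_notN pinI => /eqP->; have [] := idI i.
Qed.

(* Annihilators of nonzero elements of a Noetherian ring satisfy the ascending chain
   condition, and a maximal one is prime. *)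
Lemma exists_prime_annihilator (S : comNzRingType) (phi : {rmorphism {mpoly K[n]} -> S}) :
  exists2 p, phi p != 0 & forall q r,
    phi p * phi q * phi r = 0 -> phi p * phi q = 0 \/ phi p * phi r = 0.
Proof.
apply: contrapT => no_p.
have /choice[Q QP] p : exists q, phi p != 0 -> phi p * phi q != 0 /\
    exists2 r, phi p * phi q * phi r = 0 & phi p * phi r != 0.
  have [->|p0] := eqVneq (phi p) 0; first by exists 0.
  apply: contrapT => no_q; apply: no_p; exists p => // q r pqr.
  have [/eqP ?|pq] := boolP (phi p * phi q == 0); [by left | right].
  apply: contrapT => /eqP pr; apply: no_q; exists q => _; split=> //.
  by exists r.
(* If no annihilator were prime, each factor [Q p] would keep the image nonzero and strictly enlarge
   its annihilator. *)
pose u t := iter t (fun p => p * Q p) 1.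
have u0 t : phi (u t) != 0.
  elim: t => [|t IH] /=; first by rewrite rmorph1 oner_neq0.
  by rewrite rmorphM; have [] := QP _ IH.
have [||t tP] := @mpoly_ideal_chain (fun t r => phi (u t) * phi r = 0).
- move=> t; split=> [|p q pu qu|p q qu]; first by rewrite rmorph0 mulr0.
    by rewrite rmorphB mulrBr pu qu subr0.
  by rewrite rmorphM mulrCA qu mulr0.
- by move=> t r ur /=; rewrite rmorphM mulrAC ur mul0r.
have [_ [r]] := QP _ (u0 t); rewrite -rmorphM => /tP->.
by rewrite eqxx.
Qed.
End Noetherian.

(** * Difference-finite elements *)

(** This carries properties of the entries of a fundamental matrix to the whole ring that they
    generate. *)
Lemma mmap_closed (K S : comNzRingType) (iota : {rmorphism K -> S}) n (v : 'I_n -> S)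
  (Q : S -> Prop) :
  (forall f g, Q f -> Q g -> Q (f + g)) -> (forall f g, Q f -> Q g -> Q (f * g)) ->
  (forall a, Q (iota a)) -> (forall i, Q (v i)) -> forall p, Q (mmap iota v p).
Proof.
move=> QD QM Qiota Qv p.
have Q1 : Q 1 by rewrite -(rmorph1 iota).
apply: (big_ind Q) => [| |m _]; [by rewrite -(rmorph0 iota) | exact: QD |].
apply: (QM _ _ (Qiota _)); apply: (big_ind Q) => // i _.
by elim: (m i) => [|d IH]; rewrite ?expr0 // exprS; apply: QM.
Qed.

Section DifferenceFinite.
Variables (K : fieldType) (sigmaK : {rmorphism K -> K}).
Variables (S : comNzRingType) (sigma : {rmorphism S -> S}) (iota : {rmorphism K -> S}).
Hypothesis sigma_iota : forall a, sigma (iota a) = iota (sigmaK a).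

(** The family [v] spans a [sigma]-stable space containing [f]. Any finite index type is allowed, so
    that sums and products of elements use disjoint unions and products of index types. *)
Definition difference_finite (f : S) : Prop :=
  exists (I : finType) (v : I -> S) (B : I -> I -> K) (c : I -> K),
    (forall i, sigma (v i) = \sum_j iota (B i j) * v j) /\ f = \sum_i iota (c i) * v i.

Lemma difference_finite_const a : difference_finite (iota a).
Proof.
exists unit, (fun=> 1), (fun _ _ => 1), (fun=> a).
by split=> [_|]; rewrite big_const card_unit /= addr0 mulr1 ?rmorph1.
Qed.

Lemma difference_finite_add f g :
  difference_finite f -> difference_finite g -> difference_finite (f + g).
Proof.
move=> [I [v [B [c [vB ->]]]]] [J [w [C [d [wC ->]]]]].
exists (I + J)%type, (fun x => match x with inl i => v i | inr j => w j end),
  (fun x y => match x, y with inl i, inl i' => B i i' | inr j, inr j' => C j j'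
                            | _, _ => 0 end),
  (fun x => match x with inl i => c i | inr j => d j end).
split=> [[i|j]|]; rewrite big_sumType //=.
  by rewrite [X in _ + X]big1 ?addr0 // => j _; rewrite rmorph0 mul0r.
by rewrite [X in X + _]big1 ?add0r // => i _; rewrite rmorph0 mul0r.
Qed.

Lemma difference_finite_mul f g :
  difference_finite f -> difference_finite g -> difference_finite (f * g).
Proof.
move=> [I [v [B [c [vB ->]]]]] [J [w [C [d [wC ->]]]]].
exists (I * J)%type, (fun x => v x.1 * w x.2),
  (fun x y => B x.1 y.1 * C x.2 y.2), (fun x => c x.1 * d x.2).
have sum_pair (F : I -> S) (G : J -> S) :
    (\sum_i F i) * (\sum_j G j) = \sum_x F x.1 * G x.2.
  rewrite big_distrl /= (eq_bigr _ (fun i _ => big_distrr _ _ _)) /=.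
  exact: (pair_bigA _ (fun i j => F i * G j)).
split=> [[i j]|] /=; rewrite ?rmorphM ?vB ?wC sum_pair; apply: eq_bigr => x _;
  by rewrite rmorphM mulrACA.
Qed.

Lemma difference_finite_entry n (A : 'M[K]_n) (Y : 'M[S]_n) i j :
  map_mx sigma Y = map_mx iota A *m Y -> difference_finite (Y i j).
Proof.
move=> YA; exists 'I_n, (fun l => Y l j), (fun l m => A l m), (fun l => (i == l)%:R).
split=> [l|].
  by move/matrixP/(_ l j): YA; rewrite !mxE => ->; apply: eq_bigr => m _; rewrite mxE.
rewrite (bigD1 i) //= eqxx rmorph1 mul1r big1 ?addr0 // => l li.
by rewrite eq_sym (negPf li) rmorph0 mul0r.
Qed.

(** The coordinate vectors of [f] and its first [#|I|] shifts are [#|I| + 1] vectors in a space of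
    dimension [#|I|], hence linearly dependent. *)
Lemma difference_finite_recurrence f : difference_finite f ->
  exists n (h : 'I_n -> K),
    iter n sigma f + \sum_(j < n) iota (h j) * iter j sigma f = 0.
Proof.
move=> [I [v [B [c [vB fE]]]]].
(* [C t] gives the coordinates of the [t]-th shift of [f] with respect to [v]. *)
pose C := fix C t := if t is t'.+1 then fun j => \sum_i sigmaK (C t' i) * B i j else c.
have fC t : iter t sigma f = \sum_i iota (C t i) * v i.
  elim: t => [|t IH] //=; rewrite IH rmorph_sum /=.
  under eq_bigr => i _ do rewrite rmorphM sigma_iota vB mulr_sumr.
  rewrite exchange_big; apply: eq_bigr => j _; rewrite rmorph_sum mulr_suml.
  by apply: eq_bigr => i _; rewrite mulrA rmorphM.
pose M := \matrix_(t < #|I|.+1, j < #|I|) C t (enum_val j).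
have : kermx M != 0.
  rewrite kermx_eq0; apply/negP => /eqP rM.
  by have := rank_leq_col M; rewrite rM ltnn.
move=> /rowV0Pn[a /sub_kermxP aM a0].
have [t0 at0] : exists t, a ord0 t != 0.
  apply: contrapT => no; case/eqP: a0; apply/rowP => t; rewrite mxE.
  by apply: contrapT => /eqP at0; apply: no; exists t.
(* Dividing by the last nonzero coefficient, at index [r], makes the recurrence monic of order
   [r]. *)
case: (@arg_maxnP _ t0 (fun t => a ord0 t != 0) (fun t => t : nat) at0) => r ar rmax.
exists r, (fun j => a ord0 (inord j) / a ord0 r).
have sum0 : \sum_(t < #|I|.+1) iota (a ord0 t) * iter t sigma f = 0.
  under eq_bigr => t _ do rewrite fC mulr_sumr.
  rewrite exchange_big big1 // => i _.
  under eq_bigr => t _ do rewrite mulrA -rmorphM.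
  rewrite -mulr_suml -rmorph_sum; move/rowP/(_ (enum_rank i)): aM; rewrite !mxE.
  under eq_bigr do rewrite mxE enum_rankK.
  by move=> ->; rewrite rmorph0 mul0r.
have : \sum_(t < r.+1) iota (a ord0 (inord t)) * iter t sigma f = 0.
  rewrite (big_ord_widen #|I|.+1 (fun t => iota (a ord0 (inord t)) * iter t sigma f)) //.
  rewrite -[RHS]sum0 big_mkcond; apply: eq_bigr => t _; rewrite inord_val ltnS.
  case: leqP => // rt; have [->|/rmax] := eqVneq (a ord0 t) 0; first by rewrite rmorph0 mul0r.
  by move=> /= tr; have := leq_trans rt tr; rewrite ltnn.
rewrite big_ord_recr /= inord_val addrC => /(congr1 ( *%R (iota (a ord0 r)^-1))).
rewrite mulr0 mulrDr mulrA -rmorphM mulVf // rmorph1 mul1r mulr_sumr => rec0.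
rewrite -[RHS]rec0; congr (_ + _); apply: eq_bigr => j _.
by rewrite mulrA -rmorphM [_^-1 * _]mulrC.
Qed.
End DifferenceFinite.

(** * Supports of elements with a prime annihilator *)

Section PeriodicSupports.
Variable k : fieldType.
Implicit Types x y : Seq k.

Lemma iter_shiftE d (s : Seq k) :
  iter d (@Seq_shift k) s = to_Seq (fun t => repr s (t + d)%N).
Proof. by rewrite -[LHS]repr_Seq; apply/to_SeqP/repr_iter_shift. Qed.

Lemma mul_shift_eq0 x y i :
  x * iter i (@Seq_shift k) y = 0 ->
  ultimately (fun t => repr x t <> 0 -> repr y (t + i)%N = 0).
Proof.
move=> /Seq_eq0P; apply: ultimatelyW2.
  2: exact: (ultimatelyI (repr_SeqM x (iter i (@Seq_shift k) y)) (repr_iter_shift i y)).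
move=> t [xyE yi] xy0 /eqP xt0; move/eqP: xyE.
by rewrite xy0 yi eq_sym mulf_eq0 (negPf xt0) => /eqP.
Qed.

Definition periodic_support (s : Seq k) := ultimately_periodic (fun t => repr s t = 0).

Lemma common_period x y : periodic_support x -> periodic_support y ->
  exists2 l, (0 < l)%N & exists N,
    (forall m t, (N <= t)%N -> repr x (t + m * l)%N = 0 <-> repr x t = 0) /\
    (forall m t, (N <= t)%N -> repr y (t + m * l)%N = 0 <-> repr y t = 0).
Proof.
move=> [lx lx0 [Nx xP]] [ly ly0 [Ny yP]]; exists (lx * ly)%N; first by rewrite muln_gt0 lx0.
exists (maxn Nx Ny); split=> m t; rewrite geq_max => /andP[Nxt Nyt].
  by rewrite [(lx * ly)%N]mulnC mulnA (periodicMn xP).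
by rewrite mulnA (periodicMn yP).
Qed.

(** A common point of the two supports recurs with the common period, so the product is nonzero
    infinitely often. The threshold on [t] is uniform in [i]. *)
Lemma mul_shift_neq0 x y : periodic_support x -> periodic_support y ->
  ultimately (fun t => forall i, repr x t <> 0 -> repr y (t + i)%N <> 0 ->
    x * iter i (@Seq_shift k) y <> 0).
Proof.
move=> px py; have [l l0 [N [xP yP]]] := common_period px py.
exists N => t Nt i xt yti /mul_shift_eq0[M /(_ (t + M * l)%N) z].
apply: yti; rewrite -(yP M) 1?addnAC; last by lia.
by apply: z; [apply: leq_trans (leq_addl _ _); apply: leq_pmulr | rewrite xP].
Qed.

Variable R : Seq k -> Prop.
Hypotheses (R1 : R 1) (RM : forall x y, R x -> R y -> R (x * y)).
Hypothesis Rshift : forall x, R x -> R (Seq_shift x).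
Hypothesis Rper : forall x, R x -> periodic_support x.

Lemma R_iter_shift d x : R x -> R (iter d (@Seq_shift k) x).
Proof. by move=> Rx; elim: d => //= d; apply: Rshift. Qed.

Variable x : Seq k.
Hypotheses (Rx : R x) (x_prime : forall y z, R y -> R z ->
  x * y * z = 0 -> x * y = 0 \/ x * z = 0).

(* Modulo a common period [l], let [J] be the set of [i] such that the supports of
   [x] and [sigma^i y] meet.  As [x] has a prime annihilator, the supports of all the
   [sigma^i y] with [i] in [J] have a common point [s].  Hence the pattern of [y] seen
   from any later point [t] of the support of [x] is contained in the one seen from [s];
   iterating the translation by [t - s] [l] times leads back to the pattern at [s], so
   that both are equal. *)
Lemma support_subset y : R y -> x * y <> 0 ->
  ultimately (fun t => repr x t <> 0 -> repr y t <> 0).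
Proof.
move=> Ry xy0; have [l l0 [N1 [xP yP]]] := common_period (Rper Rx) (Rper Ry).
have [N2 xyP] := mul_shift_neq0 (Rper Rx) (Rper Ry); pose N := maxn N1 N2.
have NN1 : (N1 <= N)%N by apply: leq_maxl.
have NN2 : (N2 <= N)%N by apply: leq_maxr.
pose J (i : nat) := x * iter i (@Seq_shift k) y != 0.
pose u := \prod_(i < l | J i) iter i (@Seq_shift k) y.
have [_ xu0] : R u /\ x * u <> 0.
  rewrite /u.
  apply: (big_ind (fun u => R u /\ x * u <> 0)) => [|a b [Ra xa] [Rb xb]|i /eqP Ji].
  - by split=> //; rewrite mulr1 => x0; apply: xy0; rewrite x0 mul0r.
  - by split; [apply: RM | rewrite mulrA => /x_prime[]].
  - by split=> //; apply: R_iter_shift.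
(* Without such an [s] the product [u] would be ultimately zero, although [x * u] is not zero. *)
have [s Ns Js] : exists2 s, (N <= s)%N & forall i : 'I_l, J i -> repr y (s + i)%N <> 0.
  suff fr : ~ ultimately (fun s => ~ forall i : 'I_l, J i -> repr y (s + i)%N <> 0).
    by have [s] := frequently fr N; exists s.
  move=> noJ; apply: xu0; rewrite (_ : u = 0) ?mulr0 //.
  have -> : u = to_Seq (\prod_(i < l | J i) (fun t => repr y (t + i)%N)).
    by rewrite rmorph_prod; apply: eq_bigr => i _; rewrite iter_shiftE.
  apply/to_Seq_eq0; apply: ultimatelyW noJ => t not; rewrite fct_prodE.
  apply: contrapT => /eqP/prodf_neq0 t0; apply: not => i Ji; exact/eqP/t0.
have yr a i : (N <= a)%N -> repr y (a + i)%N = 0 <-> repr y (a + i %% l)%N = 0.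
  move=> Na; rewrite -[in X in X <-> _](yP 0%N) ?mul0n ?addn0; last by lia.
  by rewrite [in X in X <-> _](divn_eq i l) addnCA addnC yP //; lia.
exists s => t st xt.
have pattern i : repr y (t + i)%N <> 0 -> repr y (s + i)%N <> 0.
  rewrite (yr t i) 1?(yr s i) //; last by lia.
  move=> yti; apply: (Js (Ordinal (ltn_pmod i l0))) => /=.
  by apply/eqP; apply: xyP xt yti; lia.
(* The descent starts at [s + l * (t - s)], which is congruent to [s] modulo the period; each use of
   [pattern] removes one summand [t - s], and [m = l - 1] leaves the point [t]. *)
have ys m : (m < l)%N -> repr y (s + (l - m) * (t - s))%N <> 0.
  elim: m => [|m IH] ml.
    rewrite subn0 mulnC yP; last by lia.
    have := Js (Ordinal l0); rewrite addn0; apply; exact/eqP.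
  have /pattern : repr y (t + (l - m.+1) * (t - s))%N <> 0; last by [].
  have := IH (ltnW ml); rewrite (_ : l - m = (l - m.+1).+1)%N; last by lia.
  by rewrite mulSn addnA subnKC.
have := ys l.-1; rewrite (_ : l - l.-1 = 1)%N ?mul1n; last by lia.
by rewrite subnKC //; apply; lia.
Qed.

(** Take for [m] the least positive shift with [x * sigma^m x] nonzero; a period of the support is
    one candidate. By [support_subset] the support is ultimately stable under adding [m], and a
    support point in another class would produce a smaller positive shift. *)
Lemma support_residue_class : x <> 0 -> exists m t0, (0 < m)%N /\
  ultimately (fun t => repr x t <> 0 <-> t = t0 %[mod m]).
Proof.
move=> x0; have [l l0 [N1 [xP _]]] := common_period (Rper Rx) (Rper Rx).
have [N2 xxP] := mul_shift_neq0 (Rper Rx) (Rper Rx).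
have xfreq : forall N, exists2 t, (N <= t)%N & repr x t <> 0.
  apply: frequently => nx; apply: x0; apply/Seq_eq0P.
  by apply: ultimatelyW nx => t /contrapT.
have /ex_minnP[m /andP[m0 /eqP xm] mmin] :
    exists m, (0 < m)%N && (x * iter m (@Seq_shift k) x != 0).
  exists l; rewrite l0; apply/eqP; have [t Nt xt] := xfreq (maxn N1 N2).
  apply: (xxP t) => //; first by lia.
  by rewrite -[l in (t + l)%N]mul1n xP //; lia.
have [N3 x3] := ultimatelyI (support_subset (R_iter_shift m Rx) xm) (repr_iter_shift m x).
have [t0 Nt0 xt0] := xfreq (maxn N2 N3); exists m, t0; split=> //.
have xt0m j : repr x (t0 + j * m)%N <> 0.
  elim: j => [|j IH]; first by rewrite addn0.
  have [|xS xE] := x3 (t0 + j * m)%N; first by lia.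
  by rewrite mulSnr addnA -xE; apply: xS.
exists t0 => t t0t; have tE := divn_eq (t - t0) m.
have -> : (t = t0 %[mod m]) <-> ((t - t0) %% m = 0)%N.
  by split=> [/eqP|/eqP tt0]; [|apply/eqP]; rewrite eqn_mod_dvd // /dvdn => /eqP.
split=> [xt|r0]; last first.
  by have := xt0m ((t - t0) %/ m)%N; congr (repr x _ <> 0); lia.
apply: contrapT => /eqP; rewrite -lt0n => r0.
have := mmin ((t - t0) %% m)%N; rewrite r0 /= => /(_ _)/wrap[].
  apply/eqP; apply: (xxP (t0 + (t - t0) %/ m * m)%N) => //.
    by apply: leq_trans (leq_addr _ _); lia.
  by move: xt; congr (repr x _ <> 0); lia.
by rewrite leqNgt ltn_mod m0.
Qed.
End PeriodicSupports.

(** * The ring of fractions *)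

Section FundamentalMatrix.
Variables (k : fieldType) (k0 : [pchar k] =i pred0).
Variables (n : nat) (A : 'M[{fraction {poly k}}]_n).
Hypothesis A_unit : A \in unitmx.

Lemma exists_fundamental_matrix : exists Y Z : 'M[Seq k]_n,
  [/\ Y *m Z = 1%:M, Z *m Y = 1%:M &
      map_mx (@Seq_shift k) Y = map_mx (frac_to_Seq k0) A *m Y].
Proof.
have [N AN] := ultimately_frac_eval_unitmx k0 A_unit.
pose F i := map_mx (fun h => frac_eval h i%:R) A.
(* The identity matrix fills the initial terms, and the recurrence starts at [N], from where the
   coefficient matrices are invertible. *)
pose Y := fix Y i : 'M[k]_n := if i is i'.+1 then
  if (N <= i')%N then F i' *m Y i' else 1%:M else 1%:M.
have Yu i : Y i \in unitmx.
  elim: i => [|i IH] /=; first exact: unitmx1.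
  by case: leqP => [/AN Fu|_]; rewrite ?unitmx_mul ?unitmx1 //; apply/andP.
exists (to_Seq_mx Y), (to_Seq_mx (fun i => invmx (Y i))).
rewrite -!to_Seq_mxM -to_Seq_mx1 map_frac_to_Seq to_Seq_mx_shift -to_Seq_mxM.
split; apply/to_Seq_mxP.
- by exists 0%N => i _; rewrite mulmxV.
- by exists 0%N => i _; rewrite mulVmx.
- by exists N => i Ni /=; rewrite Ni.
Qed.
End FundamentalMatrix.

Section Fractions.
Variables (k : fieldType) (k0 : [pchar k] =i pred0).
Notation iota := (frac_to_Seq k0).
Notation shift := (@Seq_shift k).

Variable R : Seq k -> Prop.
Hypotheses (RB : forall x y, R x -> R y -> R (x - y)).
Hypotheses (RM : forall x y, R x -> R y -> R (x * y)).
Hypothesis Riota : forall a, R (iota a).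
Hypothesis Rshift : forall x, R x -> R (shift x).

Let R1 : R 1. Proof. by rewrite -(rmorph1 iota); apply: Riota. Qed.
Let R0 : R 0. Proof. by rewrite -(rmorph0 iota); apply: Riota. Qed.
Let RD x y : R x -> R y -> R (x + y).
Proof. by move=> Rx Ry; rewrite -[y]opprK -[- y]sub0r; apply: RB Rx _; apply: RB. Qed.

(** [R] stands for the ring [k(z)[Y_ij]]. Denominators are required to be units of [Seq k]; by
    [regular_unit] this admits all regular elements of [R], so that the total ring of fractions is
    realised inside [Seq k]. *)
Definition unit_fractions : {pred Seq k} :=
  fun s => `[< exists a b c, [/\ R a, R b, b * c = 1 & s = a * c] >].

Lemma unit_fractionsP s :
  reflect (exists a b c, [/\ R a, R b, b * c = 1 & s = a * c]) (s \in unit_fractions).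
Proof. exact: asboolP. Qed.

Lemma unit_fractions_sub s : R s -> s \in unit_fractions.
Proof. by move=> Rs; apply/unit_fractionsP; exists s, 1, 1; rewrite !mulr1. Qed.

Lemma unit_fractions_subring : subring_closed unit_fractions.
Proof.
split=> [|s t|s t]; first exact: unit_fractions_sub.
all: move=> /unit_fractionsP[a [b [c [Ra Rb bc ->]]]].
all: move=> /unit_fractionsP[a' [b' [c' [Ra' Rb' bc' ->]]]].
- apply/unit_fractionsP; exists (a * b' - a' * b), (b * b'), (c * c'); split.
  + by apply: RB; apply: RM.
  + exact: RM.
  + by rewrite mulrACA bc bc' mulr1.
  + by rewrite mulrBl mulrACA bc' mulr1 [c * c']mulrC mulrACA bc mulr1.
- apply/unit_fractionsP; exists (a * a'), (b * b'), (c * c'); split.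
  + exact: RM.
  + exact: RM.
  + by rewrite mulrACA bc bc' mulr1.
  + by rewrite mulrACA.
Qed.

(** If [a / b] is invertible in [Seq k], then so is the numerator [a], and the inverse is
    [b / a]. *)
Lemma unit_fractions_inv s d : s \in unit_fractions -> s * d = 1 -> d \in unit_fractions.
Proof.
move=> /unit_fractionsP[a [b [c [Ra Rb bc ->]]]] sd; apply/unit_fractionsP.
exists b, a, (c * d); split=> //; first by rewrite mulrA.
by rewrite mulrA bc mul1r.
Qed.

Lemma unit_fractions_shift : {in unit_fractions, forall s, shift s \in unit_fractions}.
Proof.
move=> s /unit_fractionsP[a [b [c [Ra Rb bc ->]]]]; apply/unit_fractionsP.
exists (shift a), (shift b), (shift c); split; [exact: Rshift | exact: Rshift | |].
  by rewrite -rmorphM bc rmorph1.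
by rewrite rmorphM.
Qed.

Definition unit_fraction_algebra : sigma_subalgebra shift iota :=
  SigmaSubalgebra unit_fractions_subring
    (fun a => unit_fractions_sub (Riota a)) unit_fractions_shift.

Notation L := (subalg_type unit_fraction_algebra).

Hypothesis Rper : forall x, R x -> periodic_support x.
Variable x : Seq k.
Hypothesis Rx : R x.
Hypothesis x_prime : forall y z, R y -> R z ->
  x * y * z = 0 -> x * y = 0 \/ x * z = 0.

Variables (m t0 : nat).
Hypotheses (m0 : (0 < m)%N).
Hypothesis xP : ultimately (fun t => repr x t <> 0 <-> t = t0 %[mod m]).

Lemma exists_residue t : exists i : 'I_m, t + i = t0 %[mod m].
Proof.
exists (Ordinal (ltn_pmod (t0 + (m - t %% m)) m0)) => /=; rewrite modnDmr.
rewrite {1}(divn_eq t m) -addnA modnMDl addnCA subnKC ?modnDr //.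
by rewrite ltnW ?ltn_mod.
Qed.

Lemma residue_uniq t (i j : 'I_m) :
  t + i = t0 %[mod m] -> t + j = t0 %[mod m] -> i = j.
Proof.
move=> <- /eqP; rewrite eqn_modDl !modn_small // => /eqP ji.
exact/esym/val_inj.
Qed.

(* [sigma^(i * m) x] has the same support as [x], so a further shift of [y] reduces this
   to [support_subset]. *)
Lemma residue_subset (i : nat) y : R y -> iter i shift x * y <> 0 ->
  ultimately (fun t => t + i = t0 %[mod m] -> repr y t <> 0).
Proof.
(* [j] completes [i] to a multiple of [m], as sequences can only be shifted forward. *)
move=> Ry xy0; pose j := (i * m - i)%N.
have ij : (i + j = i * m)%N by rewrite /j subnKC // leq_pmulr.
have xjy : x * iter j shift y <> 0.
  move=> /mul_shift_eq0 xjy0; apply: xy0; apply/Seq_eq0P.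
  apply: (@ultimately_subn _ j); have := ultimately_addn j (repr_SeqM (iter i shift x) y).
  apply: ultimatelyW2 (ultimatelyI xjy0 (ultimatelyI xP _)) => //.
    2: exact: (ultimatelyI (ultimately_addn j (repr_iter_shift i x)) (ultimately_addn (i * m) xP)).
  move=> t [yt0 [xt [xtij xt']]] ->; rewrite xtij -addnA [(j + i)%N]addnC ij.
  have [xt0|/eqP] := pselect (repr x t = 0); last first.
    by move=> /eqP /yt0 ->; rewrite mulr0.
  rewrite (_ : repr x (t + i * m)%N = 0) ?mul0r //; apply: contrapT.
  by move=> /xt'; rewrite addnC modnMDl => /xt.
apply: (@ultimately_subn _ j).
have /ultimatelyI/(_ xP) := support_subset R1 RM Rshift Rper Rx x_prime (R_iter_shift Rshift j Ry) xjy.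
move=> /ultimatelyI/(_ (repr_iter_shift j y)); apply: ultimatelyW.
move=> t [[xy xt] yj] tji; rewrite -yj; apply/xy/xt; rewrite -tji.
by rewrite -addnA [(j + i)%N]addnC ij addnC modnMDl.
Qed.

(** The [m] residue classes cover all indices, and [residue_subset] excludes late zeros of [y] on
    each of them. *)
Lemma unit_of_residues y : R y -> (forall i : 'I_m, iter i shift x * y <> 0) ->
  exists c, y * c = 1.
Proof.
move=> Ry xy0; apply/Seq_unitP.
apply: ultimatelyW (ultimately_forall (fun i => residue_subset Ry (xy0 i))) => t ty.
by have [i /ty] := exists_residue t.
Qed.

(** The supports of these [m] shifts ultimately partition the indices, so [u] is a unit of [Seq k],
    and the indicator of the [i]-th class is the fraction [sigma^i x / u]. *)
Let u := \sum_(i < m) iter i shift x.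

Let Ru : R u.
Proof. by apply: big_ind => // i _; apply: R_iter_shift. Qed.

Let u_val : ultimately (fun t => forall i : 'I_m, t + i = t0 %[mod m] ->
  repr u t = repr x (t + i)%N /\ repr x (t + i)%N <> 0).
Proof.
have [N xN] := xP.
have : u = to_Seq (\sum_(i < m) (fun t => repr x (t + i)%N)).
  by rewrite rmorph_sum; apply: eq_bigr => i _; rewrite iter_shiftE.
rewrite -{1}[u]repr_Seq => /to_SeqP [M uM].
exists (maxn N M) => t; rewrite geq_max => /andP[Nt Mt] i ti.
have xt (j : 'I_m) := xN (t + j)%N (leq_trans Nt (leq_addr _ _)).
split; last exact/xt.
rewrite uM // fct_sumE (bigD1 i) //= big1 ?addr0 // => j /eqP ji.
by apply: contrapT => /xt tj; apply: ji; apply: residue_uniq ti.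
Qed.

Let u_unit : exists c, u * c = 1.
Proof.
apply/Seq_unitP; apply: ultimatelyW u_val => t ut.
by have [i /ut[->]] := exists_residue t.
Qed.

Let e (i : nat) : Seq k := to_Seq (fun t => (t + i == t0 %[mod m])%:R).

Let e_u (i : 'I_m) : e i * u = iter i shift x.
Proof.
rewrite -[u]repr_Seq -rmorphM iter_shiftE; apply/to_SeqP.
have [N xN] := xP; have [M uM] := u_val.
exists (maxn N M) => t; rewrite geq_max => /andP[Nt Mt].
rewrite -[LHS]/(_%:R * repr u t); case: eqP => [/(uM _ Mt)[-> _]|ti].
  by rewrite mul1r.
rewrite mul0r; symmetry; apply: contrapT => xti; apply: ti.
by have [/(_ xti)] := xN _ (leq_trans Nt (leq_addr i t)).
Qed.

Let e_fraction (i : 'I_m) : e i \in unit_fractions.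
Proof.
have [c uc] := u_unit; apply/unit_fractionsP; exists (iter i shift x), u, c.
split=> //; first exact: R_iter_shift.
by rewrite -e_u -mulrA uc mulr1.
Qed.

Let e_idem i : e i * e i = e i.
Proof.
rewrite -rmorphM; congr to_Seq; apply/funext => t.
by rewrite -[LHS]/(_%:R * _%:R) -natrM mulnb andbb.
Qed.

Let e_orth (i j : 'I_m) : i != j -> e i * e j = 0.
Proof.
move=> ij; rewrite -rmorphM -(rmorph0 (@to_Seq k)); congr to_Seq; apply/funext => t.
rewrite -[LHS]/(_%:R * _%:R) -natrM mulnb; case: andP => // -[/eqP ti /eqP tj].
by case/eqP: ij; apply: residue_uniq ti tj.
Qed.

Let e_sum : \sum_(i < m) e i = 1.
Proof.
rewrite -rmorph_sum -(rmorph1 (@to_Seq k)); congr to_Seq; apply/funext => t.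
rewrite fct_sumE; have [i ti] := exists_residue t.
rewrite (bigD1 i) //= ti eqxx big1 ?addr0 // => j /eqP ji.
by case: eqP => // tj; case: ji; apply: residue_uniq ti.
Qed.

Let e_shift (i : 'I_m) : shift (e i) = e (ordS i).
Proof.
rewrite Seq_shiftE; congr to_Seq; apply/funext => t.
by rewrite /= modnDmr addSnnS.
Qed.

Let e_neq0 (i : 'I_m) : e i != 0.
Proof.
(* This index is at least [N] and lies in the [i]-th class. *)
apply/eqP => /to_Seq_eq0[N eN]; have := eN (N * m + (t0 + (m - i)))%N.
have -> : (N * m + (t0 + (m - i)) + i = N.+1 * m + t0)%N by have := ltn_ord i; lia.
rewrite modnMDl eqxx => e1; have /eqP : 1%:R = 0 :> k.
  by apply: e1; apply: leq_trans (leq_addr _ _); apply: leq_pmulr.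
by rewrite oner_eq0.
Qed.

(** For [s = a / b], the element [sigma^i x * a] of [R] is nonzero and is completed outside the
    [i]-th class to a unit [w]; the inverse on that class is [b * sigma^i x / w]. *)
Let e_inv (i : 'I_m) s : s \in unit_fractions -> e i * s <> 0 ->
  exists2 y, y \in unit_fractions & (e i * s) * (e i * y) = e i.
Proof.
move=> /unit_fractionsP[a [b [c [Ra Rb bc ->]]]] eac0.
have Rxi := R_iter_shift Rshift i Rx.
have u_reg z : u * z = 0 -> z = 0.
  by have [d ud] := u_unit => uz; rewrite -[z]mul1r -ud mulrAC uz mul0r.
have xia0 : iter i shift x * a <> 0.
  by rewrite -e_u mulrAC mulrC => /u_reg eia; apply: eac0; rewrite mulrA eia mul0r.
(* [w] agrees with [sigma^i x * a] on the i-th residue class and with [u] elsewhere. *)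
pose w := iter i shift x * a + (u - iter i shift x).
have Rw : R w by apply: RD; [apply: RM | apply: RB].
have eiw : e i * w = iter i shift x * a.
  by rewrite mulrDr mulrBr e_u -e_u !mulrA e_idem subrr addr0.
have ejw (j : 'I_m) : i != j -> e j * w = iter j shift x.
  move=> ij; rewrite mulrDr mulrBr -(e_u i) !mulrA [e j * e i]mulrC e_orth //.
  by rewrite !mul0r add0r subr0 e_u.
have [|d wd] := unit_of_residues Rw.
  move=> j; rewrite -e_u mulrAC mulrC => /u_reg.
  have [<-|/ejw ->] := eqVneq i j; first by rewrite eiw.
  by rewrite -e_u mulrC => /u_reg /eqP; apply/negP.
exists (b * iter i shift x * d).
  apply/unit_fractionsP; exists (b * iter i shift x), w, d.
  by split=> //; apply: RM.
transitivity (e i * (e i * (iter i shift x * a)) * (b * c) * d); first by ring.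
by rewrite bc mulr1 -eiw mulrA e_idem mulrA e_idem -mulrA wd mulr1.
Qed.

Lemma unit_fraction_pseudo_field :
  pseudo_field (@sub_sigma _ _ _ _ unit_fraction_algebra).
Proof.
pose E (i : 'I_m) : L := exist _ (e i) (e_fraction i).
exists m, E; split=> //.
- split=> [i|i j ij]; apply: val_inj; first by rewrite rmorphM /= e_idem.
  by rewrite rmorphM /= e_orth ?rmorph0.
- have E_orth i j : i != j -> E i * E j = 0.
    by move=> ij; apply: val_inj; rewrite rmorphM /= e_orth ?rmorph0.
  split=> [z|y Ey0 i].
    exists (fun=> z); rewrite -mulr_suml (_ : \sum_i E i = 1) ?mul1r //.
    by apply: val_inj; rewrite rmorph_sum rmorph1 /= e_sum.
  have := congr1 ( *%R (E i)) Ey0; rewrite mulr0 mulr_sumr (bigD1 i) //=.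
  rewrite big1 ?addr0 => [<-|j ji]; last by rewrite mulrA E_orth ?mul0r // eq_sym.
  by rewrite mulrA; congr (_ * _); apply: val_inj; rewrite rmorphM /= e_idem.
- by move=> i; apply: val_inj; rewrite /= e_shift.
- move=> i; split; first by apply: contraNneq (e_neq0 i) => /(congr1 val)/= ->.
  move=> z Ez; have [|y yL ey] := @e_inv i (val z) (valP z).
    by move=> ez; case/eqP: Ez; apply: val_inj; rewrite rmorphM.
  by exists (exist _ y yL); apply: val_inj; rewrite !rmorphM.
Qed.

(** A regular element cannot annihilate the nonzero elements [sigma^i x] of [R], so
    [unit_of_residues] applies. *)
Lemma regular_unit b : R b -> (forall c, R c -> b * c = 0 -> c = 0) ->
  exists c, b * c = 1.
Proof.
move=> Rb breg; apply: unit_of_residues => // i xib.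
have xi0 : iter i shift x = 0.
  by apply: breg; [apply: R_iter_shift | rewrite mulrC].
by case/eqP: (e_neq0 i); have [c uc] := u_unit; rewrite -[e i]mulr1 -uc mulrA e_u xi0 mul0r.
Qed.

End Fractions.

(** * The Picard-Vessiot extension inside [Seq k] *)

Section PicardVessiot.
Variables (k : fieldType) (k0 : [pchar k] =i pred0).
Notation iota := (frac_to_Seq k0).
Notation shift := (@Seq_shift k).

Hypothesis recurrence_zeros : forall (n : nat) (h : 'I_n -> {fraction {poly k}}) (f : nat -> k),
  (0 < n)%N ->
  (exists N, forall i, (N <= i)%N ->
    f (i + n)%N + \sum_(j < n) frac_eval (h j) i%:R * f (i + j)%N = 0) ->
  finite_union_of_AP (fun i => f i = 0).

Lemma difference_finite_periodic s :
  difference_finite shift iota s -> periodic_support s.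
Proof.
move=> /(difference_finite_recurrence (frac_to_Seq_shift k0))[[|n] [h]].
  (* A recurrence of order 0, outside the scope of [recurrence_zeros], says that [s] is zero. *)
  rewrite big_ord0 addr0 /= => /Seq_eq0P s0; exists 1%N => //.
  by apply: ultimatelyW2 s0 (ultimately_addn 1 s0) => i.
move=> hs; apply/finite_union_of_APP/(@recurrence_zeros n.+1 h) => //.
apply/to_Seq_eq0; rewrite -hs iter_shiftE.
rewrite -[LHS]/(to_Seq ((fun i => repr s (i + n.+1)%N) + _)) rmorphD; congr (_ + _).
under eq_bigr do rewrite iter_shiftE /frac_to_Seq -to_SeqM.
rewrite -rmorph_sum; congr to_Seq; apply/funext => i.
by rewrite fct_sumE.
Qed.

Variables (n : nat) (A : 'M[{fraction {poly k}}]_n).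
Hypothesis A_unit : A \in unitmx.

Lemma exists_picard_vessiot :
  exists L : sigma_subalgebra shift iota,
    picard_vessiot (@frac_shift k) (@sub_sigma _ _ _ _ L) (@sub_iota _ _ _ _ L) A.
Proof.
have [Y [Z [YZ ZY YA]]] := exists_fundamental_matrix k0 A_unit.
pose v i := mxvec Y ord0 i.
pose phi : {rmorphism {mpoly {fraction {poly k}}[n * n]} -> Seq k} := mmap iota v.
pose R s := exists p, s = phi p.
have RB x y : R x -> R y -> R (x - y).
  by move=> [p ->] [q ->]; exists (p - q); rewrite rmorphB.
have RD x y : R x -> R y -> R (x + y).
  by move=> [p ->] [q ->]; exists (p + q); rewrite rmorphD.
have RM x y : R x -> R y -> R (x * y).
  by move=> [p ->] [q ->]; exists (p * q); rewrite rmorphM.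
have Riota a : R (iota a) by exists a%:MP; rewrite /phi /= mmapC.
have RY i j : R (Y i j).
  by exists 'X_(mxvec_index i j); rewrite /phi /= mmapX mmap1U /v mxvecE.
have Yshift i j : shift (Y i j) = \sum_l iota (A i l) * Y l j.
  by move/matrixP/(_ i j): YA; rewrite !mxE => ->; apply: eq_bigr => l _; rewrite mxE.
have Rshift s : R s -> R (shift s).
  move=> [p ->]; apply: (@mmap_closed _ _ _ _ _ (fun s => R (shift s))) => [f g|f g|a|i].
  - by rewrite rmorphD; apply: RD.
  - by rewrite rmorphM; apply: RM.
  - by rewrite frac_to_Seq_shift; apply: Riota.
  - case/mxvec_indexP: i => i j; rewrite /v mxvecE Yshift.
    apply: (big_ind R) => [||l _]; [by rewrite -(rmorph0 iota); apply: Riota | exact: RD |].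
    exact: RM.
have Rper s : R s -> periodic_support s.
  move=> [p ->]; apply: difference_finite_periodic.
  apply: mmap_closed => [||a|i].
  - exact: difference_finite_add.
  - exact: difference_finite_mul.
  - exact: difference_finite_const.
  - case/mxvec_indexP: i => i j; rewrite /v mxvecE; exact: difference_finite_entry YA.
have [p /eqP x0 p_prime] := exists_prime_annihilator phi.
pose x := phi p; have Rx : R x by exists p.
have x_prime y z : R y -> R z -> x * y * z = 0 -> x * y = 0 \/ x * z = 0.
  by move=> [q ->] [r ->]; apply: p_prime.
have R1 : R 1 by rewrite -(rmorph1 iota); apply: Riota.
have [m [t0 [m0 xP]]] := support_residue_class R1 RM Rshift Rper Rx x_prime x0.
pose L := unit_fraction_algebra RB RM Riota Rshift; exists L.
have R_L s : R s -> s \in subalg_pred L by move=> Rs; exact: unit_fractions_sub.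
have reg_unit := regular_unit RM Riota Rshift Rper Rx x_prime m0 xP.
split.
- exact: (unit_fraction_pseudo_field RB RM Riota Rshift Rper Rx x_prime m0 xP).
- by move=> a; apply: val_inj; rewrite /= frac_to_Seq_shift.
- have Lval (B : 'M[Seq k]_n) : (forall i j, B i j \in subalg_pred L) ->
      exists C : 'M[subalg_type L]_n, map_mx val C = B.
    move=> BL; exists (\matrix_(i, j) exist _ (B i j) (BL i j)).
    by apply/matrixP => i j; rewrite !mxE.
  have [YL YE] := Lval Y (fun i j => R_L _ (RY i j)).
  have vE p' : val (mmap (@sub_iota _ _ _ _ L) (fun i => mxvec YL ord0 i) p') = phi p'.
    rewrite -[phi _]/(mmap iota v p') /mmap rmorph_sum; apply: eq_bigr => m' _; rewrite rmorphM.
    congr (_ * _); rewrite rmorph_prod; apply: eq_bigr => i _; rewrite rmorphXn /=.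
    by rewrite /v -YE -map_mxvec mxE.
  have adjP z : adjoin_entries (@sub_iota _ _ _ _ L) YL z <-> R (val z).
    split=> [[q ->]|[q zq]]; exists q; first exact: vE.
    by apply: val_inj; rewrite vE.
  have detYZ : \det (map_mx val YL) * \det Z = 1 by rewrite YE -det_mulmx YZ det1.
  (* The inverse of the determinant lies in [L], and the adjugate then yields an inverse of [YL]
     with entries in [L]. *)
  have dL : \det Z \in subalg_pred L.
    by apply: unit_fractions_inv detYZ; rewrite det_map_mx; apply: valP.
  pose d : subalg_type L := exist _ (\det Z) dL.
  have detYd : \det YL * d = 1 by apply: val_inj; rewrite rmorphM -det_map_mx rmorph1.
  exists YL; split.
  + exists (d *: \adj YL); rewrite -scalemxAr -scalemxAl mul_mx_adj mul_adj_mx.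
    by rewrite scale_scalar_mx mulrC detYd.
  + apply/matrixP => i j; apply: val_inj; rewrite !mxE rmorph_sum.
    have YEij a b : val (YL a b) = Y a b by rewrite -YE mxE.
    rewrite -[LHS]/(shift (val (YL i j))) YEij Yshift; apply: eq_bigr => l _.
    by rewrite rmorphM /= mxE YEij.
  + have reg b : R (val b) -> (forall c, R (val c) -> b * c = 0 -> c = 0) ->
        exists c : subalg_type L, b * c = 1.
      move=> Rb breg; have [c bc] : exists c, val b * c = 1.
        apply: reg_unit => // c Rc bc0.
        apply: (congr1 val (breg (exist _ c (R_L _ Rc)) Rc _)).
        by apply: val_inj; rewrite rmorphM /= bc0.
      have cL : c \in subalg_pred L by apply: unit_fractions_inv bc; apply: valP.
      by exists (exist _ c cL); apply: val_inj; rewrite rmorphM.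
    split=> [b [/adjP Rb breg]|s].
      by apply: reg => // c /adjP; apply: breg.
    have /unit_fractionsP[a [b [c [Ra Rb bc sE]]]] := valP s.
    exists (exist _ a (R_L _ Ra)), (exist _ b (R_L _ Rb)); split.
    * exact/adjP.
    * split=> [|z _ bz0]; first exact/adjP.
      apply: val_inj; rewrite rmorph0 -[LHS]mul1r -bc mulrAC.
      by have := congr1 val bz0; rewrite rmorphM rmorph0 /= => ->; rewrite mul0r.
    * by apply: val_inj; rewrite rmorphM /= sE mulrCA bc mulr1.
- move=> s; split=> [ss|[a aa ->]]; last by apply: val_inj; rewrite /= frac_to_Seq_shift aa.
  have [c sc] := Seq_shift_const (congr1 val ss).
  exists (FracField.tofrac c%:P); last by apply: val_inj; rewrite sc /= frac_to_Seq_polyC.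
  rewrite /= (@frac_shiftE _ _ c%:P 1) ?oner_neq0 ?tofrac1 ?divr1 //.
  by rewrite comp_polyC rmorph1 tofrac1 divr1.
Qed.
End PicardVessiot.

(** * Orbits and recurrences *)

Section Recurrences.
Variables (k : fieldType) (k0 : [pchar k] =i pred0).

Definition companion n (h : 'I_n.+1 -> {fraction {poly k}}) : 'M[{fraction {poly k}}]_n.+1 :=
  \matrix_(i, j) if (i < n)%N then (j == i.+1 :> nat)%:R else - h j.

(** On a vector of the kernel, the shift rows kill all coordinates but the first, and the last row
    kills the first because [h ord0] is nonzero. *)
Lemma companion_unit n (h : 'I_n.+1 -> {fraction {poly k}}) :
  h ord0 != 0 -> companion h \in unitmx.
Proof.
move=> h0; rewrite -unitmx_tr -row_free_unit; apply: inj_row_free => v vA.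
have vS (j : 'I_n.+1) : (0 < j)%N -> v ord0 j = 0.
  move=> j0; have ji : (j.-1 < n)%N by have := ltn_ord j; lia.
  move/rowP/(_ (widen_ord (leqnSn n) (Ordinal ji))): vA; rewrite !mxE (bigD1 j) //=.
  rewrite !mxE /= ji prednK // eqxx mulr1 big1 ?addr0 // => l lj.
  by rewrite !mxE /= ji prednK // (negPf (lj : l != j :> nat)) mulr0.
apply/rowP => j; rewrite mxE; have [j0|/vS//] := posnP j.
have -> : j = ord0 by apply: val_inj.
move/rowP/(_ ord_max): vA; rewrite !mxE (bigD1 ord0) //= !mxE ltnn big1.
  by rewrite addr0 mulrN => /eqP; rewrite oppr_eq0 mulf_eq0 (negPf h0) orbF => /eqP.
by move=> l l0; rewrite vS ?mul0r // lt0n.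
Qed.

(** Supplies the starting matrix of an orbit: lower triangular, invertible once [u ord0] is nonzero,
    with a window of the solution as first column. *)
Definition replace_first_column n (u : 'I_n.+1 -> k) : 'M[k]_n.+1 :=
  \matrix_(i, j) if j == ord0 then u i else (i == j)%:R.

Lemma replace_first_column_unit n (u : 'I_n.+1 -> k) :
  u ord0 != 0 -> replace_first_column u \in unitmx.
Proof.
move=> u0; rewrite unitmxE unitfE det_trig; last first.
  apply/is_trig_mxP => i j ij; rewrite mxE.
  case: eqP => [j0|_]; first by rewrite j0 in ij.
  by case: eqP => // ij'; rewrite ij' ltnn in ij.
apply/prodf_neq0 => i _; rewrite mxE eqxx.
by case: (i =P ord0) => [->|_]; rewrite ?oner_neq0.
Qed.

Hypothesis orbit_zero_locus : forall (n : nat) (A : 'M[{fraction {poly k}}]_n),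
  (0 < n)%N -> A \in unitmx ->
  forall (E : seq {mpoly k[1 + n * n + 1]}) (x : k * 'M[k]_n),
    in_X x -> orbit_defined A x ->
    finite_union_of_AP (fun i => zero_locus E (iter i (sigma_map A) x)).

(** Induction on the order: if [h ord0] vanishes, [f] shifted by one satisfies a recurrence of
    smaller order. Otherwise the companion matrix is invertible and its orbit has the values of [f]
    in the first column. *)
Lemma recurrence_zeros_of_orbits n (h : 'I_n -> {fraction {poly k}}) (f : nat -> k) :
  ultimately (fun i => f (i + n)%N + \sum_(j < n) frac_eval (h j) i%:R * f (i + j)%N = 0) ->
  ultimately_periodic (fun i => f i = 0).
Proof.
have ultimately0 (g : nat -> k) :
    ultimately (fun i => g i = 0) -> ultimately_periodic (fun i => g i = 0).
  by move=> g0; exists 1%N => //; apply: ultimatelyW2 g0 (ultimately_addn 1 g0) => i.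
elim: n h f => [|n IH] h f rec.
  by apply: ultimately0; apply: ultimatelyW rec => i; rewrite big_ord0 addr0 addn0.
have [h0|h0] := eqVneq (h ord0) 0.
  apply: (@ultimately_periodic_addn _ 1); apply: (IH (fun j => h (lift ord0 j))).
  apply: ultimatelyW rec => i; rewrite big_ord_recl h0.
  rewrite -(tofrac0 {poly k}) -(rmorph0 polyC) frac_eval_polyC mul0r add0r addn1 addnS.
  move=> rec0; rewrite -[RHS]rec0; congr (_ + _); apply: eq_bigr => j _.
  by rewrite /= /bump /= add1n addn1 addnS.
have [fz|/frequently ffreq] := pselect (ultimately (fun i => ~ (f i <> 0))).
  by apply: ultimately0; apply: ultimatelyW fz => i /contrapT.
pose A := companion h; have Au : A \in unitmx by apply: companion_unit.
have nopole : ultimately (fun i => forall a b, ~~ has_pole (A a b) i%:R).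
  have := ultimately_forall (fun ab => ultimately_no_pole k0 (A ab.1 ab.2)).
  by apply: ultimatelyW => i np a b; apply: (np (a, b)).
have detA : ultimately (fun i => frac_eval (\det A) i%:R != 0).
  by apply: ultimately_frac_eval_neq0 => //; move: Au; rewrite unitmxE unitfE.
have evalN : ultimately (fun i => forall j, frac_eval (- h j) i%:R = - frac_eval (h j) i%:R).
  apply: ultimately_forall => j; apply/to_SeqP.
  rewrite -[RHS]/(to_Seq (- (fun i => frac_eval (h j) i%:R))) rmorphN.
  exact: (rmorphN (frac_to_Seq k0)).
have evalA := ultimately_frac_eval_unitmx k0 Au.
have [N0 good] := ultimatelyI (ultimatelyI nopole detA)
  (ultimatelyI evalN (ultimatelyI evalA rec)).
have [N NN0 fN] := ffreq N0.
(* The base point is chosen with [f N <> 0], so that the matrix below is invertible. *)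
pose x : k * 'M[k]_n.+1 := (N%:R, replace_first_column (fun i : 'I_n.+1 => f (N + i)%N)).
have orbit i : let y := iter i (sigma_map A) x in
    [/\ y.1 = (N + i)%:R, in_X y & forall r, y.2 r ord0 = f (N + i + r)%N].
  elim: i => [|i /= [y1 yX yf]] /=.
    split; rewrite ?addn0 //; last by move=> r; rewrite mxE eqxx.
    by apply: replace_first_column_unit; rewrite addn0; apply/eqP.
  have [_ [eN [eA frec]]] := good (N + i)%N (leq_trans NN0 (leq_addr _ _)).
  set y := iter i _ x in y1 yX yf *; split; first by rewrite y1 natr1 addnS.
    by rewrite /in_X /= unitmx_mul y1 eA.
  move=> r; rewrite !mxE y1.
  have [rn|nr] := ltnP r n.
    rewrite (bigD1 (inord r.+1)) //= !mxE rn inordK ?ltnS // eqxx.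
    rewrite -(tofrac1 {poly k}) -(rmorph1 polyC) frac_eval_polyC mul1r yf inordK ?ltnS //.
    have -> : (N + i.+1 + r = N + i + r.+1)%N by lia.
    rewrite big1 ?addr0 // => j jr; rewrite !mxE rn.
    rewrite (_ : (j == r.+1 :> nat) = false) /=.
      by rewrite mulr0n -(tofrac0 {poly k}) -(rmorph0 polyC) frac_eval_polyC mul0r.
    by apply: contraNF jr => /eqP jr; apply/eqP/val_inj; rewrite /= inordK.
  have -> : (N + i.+1 + r = N + i + n.+1)%N by have := ltn_ord r; lia.
  apply: (addIr (\sum_(j < n.+1) frac_eval (h j) (N + i)%:R * f (N + i + j)%N)).
  rewrite frec -big_split big1 //= => j _.
  by rewrite !mxE ltnNge nr /= eN yf mulNr addNr.
(* The coordinate of the top left matrix entry, whose zero locus records the zeros of [f]. *)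
pose idx : 'I_(1 + n.+1 * n.+1 + 1) := lshift 1 (rshift 1 (mxvec_index ord0 ord0)).
apply: (@ultimately_periodic_addn _ N); apply/finite_union_of_APP.
have [_ xX _] := orbit 0%N.
have xdef : orbit_defined A x.
  move=> i; have [y1 _ _] := orbit i; rewrite /sigma_dom y1.
  by have [[? ?] _] := good (N + i)%N (leq_trans NN0 (leq_addr _ _)).
have /finite_union_of_APP := orbit_zero_locus (ltn0Sn n) Au [:: 'X_idx] xX xdef.
move=> zl; apply/finite_union_of_APP; apply: ultimately_iff zl; apply: ultimatelyT => i.
have [_ yX yf] := orbit i.
have -> : f (i + N)%N = coord_eval 'X_idx (iter i (sigma_map A) x).
  by rewrite /coord_eval mevalXU /coord_vec row_mxEl row_mxEr mxvecE yf addn0 addnC.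
split=> [[_ ->]|fz] //; first by rewrite mem_head.
by split=> // P; rewrite inE => /eqP->.
Qed.
End Recurrences.

(** * Pseudo fields of sequences *)

Lemma ultimately_periodicI (P Q : nat -> Prop) :
  ultimately_periodic P -> ultimately_periodic Q -> ultimately_periodic (fun i => P i /\ Q i).
Proof.
move=> [l l0 [N PN]] [l' l'0 [N' QN]]; exists (l * l')%N; first by rewrite muln_gt0 l0.
exists (maxn N N') => i; rewrite geq_max => /andP[Ni N'i].
by rewrite (periodicMn QN) // mulnC (periodicMn PN).
Qed.

Section PseudoFieldsOfSequences.
Variables (k : fieldType) (k0 : [pchar k] =i pred0).
Notation iota := (frac_to_Seq k0).
Notation shift := (@Seq_shift k).
Variable L : sigma_subalgebra shift iota.

(** The [l]-th shift fixes each [e_i], so its support is ultimately [l]-periodic, and these supports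
    cover all late indices as the [e_i] generate the unit ideal. On the support of [e_i], the
    sequence [s] ultimately vanishes everywhere or nowhere, since [e_i * s] is zero or invertible in
    a field. *)
Lemma pseudo_field_periodic s : pseudo_field (@sub_sigma _ _ _ _ L) ->
  s \in subalg_pred L -> periodic_support s.
Proof.
move=> [l [e [l0 _ [e_gen _] e_shift e_field]]] sL.
pose E i := val (e i); pose z : subalg_type L := exist _ s sL.
have iterE d i : iter d shift (E i) = E (iter d (@ordS l) i).
  by elim: d => //= d ->; rewrite /E -e_shift.
have ordSl d (i : 'I_l) : iter d (@ordS l) i = ((i + d) %% l)%N :> nat.
  elim: d => [|d IH] /=; first by rewrite addn0 modn_small.
  by rewrite IH -addn1 modnDml addn1 addnS.
have El i : iter l shift (E i) = E i.
  by rewrite iterE; congr E; apply: ord_inj; rewrite ordSl modnDr modn_small.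
have [y yE] := e_gen 1.
have cover : ultimately (fun t => exists i, repr (E i) t <> 0).
  have : (1 : Seq k) = \sum_i E i * val (y i).
    by rewrite -[LHS](rmorph1 (val : subalg_type L -> Seq k)) yE rmorph_sum;
       apply: eq_bigr => i _; rewrite rmorphM.
  have -> : \sum_i E i * val (y i) =
      to_Seq (\sum_i (fun t => repr (E i) t * repr (val (y i)) t)).
    rewrite rmorph_sum; apply: eq_bigr => i _.
    by rewrite -{1}[E i]repr_Seq -{1}[val _]repr_Seq -rmorphM.
  rewrite -to_Seq1 => /to_SeqP[N yN]; exists N => t /yN yt.
  apply: contrapT => no; have : (1 : k) != 0 by apply: oner_neq0.
  rewrite (_ : 1 = (1 : nat -> k) t) // yt fct_sumE big1 ?eqxx // => i _.
  have [->|/eqP Ei] := eqVneq (repr (E i) t) 0; first by rewrite mul0r.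
  by case: no; exists i.
have zeros i : ultimately (fun t => repr (E i) t <> 0 -> repr s t = 0 <-> E i * s = 0).
  have [Es0|Es0] := pselect (E i * s = 0).
    have := mul_shift_eq0 (i := 0) Es0; apply: ultimatelyW => t Ez Ei.
    by split=> // _; rewrite -(addn0 t); apply: Ez.
  have [|w wE] := (e_field i).2 z.
    by apply/eqP => ez; apply: Es0; rewrite -[LHS]/(val (e i * z)) ez rmorph0.
  have /(congr1 val) : (e i * z) * (e i * w) = e i := wE.
  rewrite !rmorphM -/(E i) => wE'.
  have := ultimatelyI (repr_SeqM (E i * s) (E i * val w)) (repr_SeqM (E i) s).
  apply: ultimatelyW => t [Et Est] Ei; split=> // st.
  by case: Ei; rewrite -wE' Et Est st mulr0 mul0r.
have [N good] := ultimatelyI (ultimatelyI cover (ultimately_forall zeros))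
  (ultimately_forall (fun i => repr_iter_shift l (E i))).
exists l => //; exists N => t Nt.
have [[[i Ei] zt] Et] := good t Nt.
have [[_ ztl] _] := good (t + l)%N (leq_trans Nt (leq_addr _ _)).
by rewrite (zt i Ei) (ztl i) // -Et El.
Qed.

Lemma Seq_constant_in_subalgebra s : shift s = s -> s \in subalg_pred L.
Proof.
move=> /Seq_shift_const[c ->]; rewrite -(frac_to_Seq_polyC k0 c).
exact: (subalg_const L).
Qed.
End PseudoFieldsOfSequences.

(** * Orbits via Picard-Vessiot extensions *)

Section Orbits.
Variables (k : fieldType) (k0 : [pchar k] =i pred0).
Notation iota := (frac_to_Seq k0).
Notation shift := (@Seq_shift k).

Hypothesis picard_vessiot_in_Seq : forall (n : nat) (A : 'M[{fraction {poly k}}]_n),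
  (0 < n)%N -> A \in unitmx ->
  exists L : sigma_subalgebra shift iota,
    picard_vessiot (@frac_shift k) (@sub_sigma _ _ _ _ L) (@sub_iota _ _ _ _ L) A.

Variables (n : nat) (A : 'M[{fraction {poly k}}]_n).
Hypotheses (n0 : (0 < n)%N) (A_unit : A \in unitmx).

Lemma orbit_zero_locus_of_picard_vessiot (E : seq {mpoly k[1 + n * n + 1]})
    (x : k * 'M[k]_n) :
  finite_union_of_AP (fun i => zero_locus E (iter i (sigma_map A) x)).
Proof.
apply/finite_union_of_APP.
pose B i := (iter i (sigma_map A) x).2.
have b_iter i : (iter i (sigma_map A) x).1 = x.1 + i%:R.
  by elim: i => [|i IH]; rewrite ?addr0 //= IH -addrA natr1.
pose F i := map_mx (fun h => frac_eval h (x.1 + i%:R)) A.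
have BS i : B i.+1 = F i *m B i by rewrite /B /= b_iter.
(* The orbit evaluates [A] at [x.1 + i], so its matrices solve the system of the translated matrix
   [A']. *)
pose A' := map_mx (frac_translate x.1) A.
have A'u : A' \in unitmx by rewrite map_unitmx.
have FE : map_mx iota A' = to_Seq_mx F.
  apply/matrixP => i j; rewrite !mxE frac_translate_to_Seq.
  by congr to_Seq; apply/funext => t; rewrite mxE.
have [N Fu] : ultimately (fun i => F i \in unitmx).
  have : map_mx iota A' *m map_mx iota (invmx A') = 1%:M.
    by rewrite -map_mxM mulmxV // map_mx1.
  rewrite FE map_frac_to_Seq -to_Seq_mxM -to_Seq_mx1 => /to_Seq_mxP.
  by apply: ultimatelyW => i /mulmx1_unit[].
have Bu i : (N <= i)%N -> (B i \in unitmx) = (B N \in unitmx).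
  move=> Ni; rewrite -(subnK Ni); elim: (i - N)%N => [|d IH] //.
  by rewrite addSn BS unitmx_mul IH Fu ?leq_addl.
have [BN|BN] := boolP (B N \in unitmx); last first.
  (* With [B N] singular, all later points are outside [X], and the set is finite. *)
  exists 1%N => //; exists N => i Ni.
  by split=> -[]; rewrite /in_X -/(B _) Bu ?(negPf BN) //; lia.
have [L [pf _ [Y [[Z [YZ ZY]] YA _]] _]] := picard_vessiot_in_Seq n0 A'u.
pose Bs := to_Seq_mx B; pose Bi := to_Seq_mx (fun i => invmx (B i)).
have BsBi : Bs *m Bi = 1%:M.
  rewrite -to_Seq_mxM -to_Seq_mx1; apply/to_Seq_mxP.
  by exists N => i Ni; rewrite mulmxV // Bu.
have BsA : map_mx shift Bs = map_mx iota A' *m Bs.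
  rewrite to_Seq_mx_shift FE -to_Seq_mxM; apply/to_Seq_mxP.
  by exists 0%N => i _; rewrite BS.
pose Ys := map_mx val Y; pose Zs := map_mx val Z.
have YsZs : Ys *m Zs = 1%:M by rewrite -map_mxM YZ map_mx1.
have ZsYs : Zs *m Ys = 1%:M by rewrite -map_mxM ZY map_mx1.
have YsA : map_mx shift Ys = map_mx iota A' *m Ys.
  have := congr1 (map_mx val) YA; rewrite map_mxM => YA'.
  have -> : map_mx shift Ys = map_mx val (map_mx (@sub_sigma _ _ _ _ L) Y).
    by apply/matrixP => i j; rewrite !mxE.
  by rewrite YA'; congr (_ *m _); apply/matrixP => i j; rewrite !mxE.
(* The quotient of two fundamental matrices of the same system is fixed by the shift; its entries
   are constants, so that [Bs = Ys *m D] has entries in [L]. *)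
pose D := Zs *m Bs.
have shiftD : map_mx shift D = D.
  have ZsA : map_mx shift Zs *m map_mx iota A' = Zs.
    rewrite -[LHS]mulmx1 -YsZs mulmxA -[_ *m _ *m Ys]mulmxA -YsA -map_mxM ZsYs.
    by rewrite map_mx1 mul1mx.
  by rewrite map_mxM BsA mulmxA ZsA.
have DL i j : D i j \in subalg_pred L.
  by apply: Seq_constant_in_subalgebra; move/matrixP/(_ i j): shiftD; rewrite mxE.
have YsL i j : Ys i j \in subalg_pred L by rewrite mxE; apply: valP.
have BsL i j : Bs i j \in subalg_pred L.
  rewrite -[Bs]mul1mx -YsZs -mulmxA mxE; apply: rpred_sum => l _.
  exact: rpredM.
have detBiL : \det Bi \in subalg_pred L.
  (* [c] is the inverse of the constant [\det D], hence itself constant, and [\det Bi] is [c] times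
     the element [\det Z] of [L]. *)
  pose c := \det (Bi *m Ys).
  have Dc : \det D * c = 1.
    by rewrite -det_mulmx mulmxA -[D *m Bi]mulmxA BsBi mulmx1 ZsYs det1.
  have shift_c : shift c = c.
    have := congr1 shift Dc; rewrite rmorphM rmorph1 -{1}det_map_mx shiftD => Dsc.
    by rewrite -[LHS]mul1r -Dc mulrAC Dsc mul1r.
  have -> : \det Bi = c * val (\det Z).
    by rewrite -det_map_mx -det_mulmx -mulmxA YsZs mulmx1.
  by apply: rpredM; [apply: Seq_constant_in_subalgebra | apply: valP].
have coordL i : to_Seq (fun t => coord_vec (iter t (sigma_map A) x) ord0 i) \in subalg_pred L.
  case: (split_ordP i) => [j ->|j ->].
    case: (split_ordP j) => [r ->|r ->].
      have -> : (fun t => coord_vec (iter t (sigma_map A) x) ord0 (lshift 1 (lshift (n * n) r)))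
          = (fun t => ('X + x.1%:P).[t%:R]).
        apply/funext => t; rewrite /coord_vec !row_mxEl mxE !ord1 eqxx b_iter.
        by rewrite hornerD hornerX hornerC addrC.
      by rewrite -(frac_to_Seq_poly k0); apply: (subalg_const L).
    case/mxvec_indexP: r => a b; have := BsL a b; rewrite mxE.
    suff -> : (fun t => B t a b) = fun t => coord_vec (iter t (sigma_map A) x) ord0
      (lshift 1 (rshift 1 (mxvec_index a b))) by [].
    by apply/funext => t; rewrite /coord_vec row_mxEl row_mxEr mxvecE.
  move: detBiL; rewrite to_Seq_mx_det.
  suff -> : (fun t => \det (invmx (B t))) =
    fun t => coord_vec (iter t (sigma_map A) x) ord0 (rshift _ j) by [].
  by apply/funext => t; rewrite /coord_vec row_mxEr mxE !ord1 eqxx det_inv.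
have evalL P : to_Seq (fun t => coord_eval P (iter t (sigma_map A) x)) \in subalg_pred L.
  have -> : (fun t => coord_eval P (iter t (sigma_map A) x)) =
      \sum_(m <- msupp P) (fun=> P@_m) *
        \prod_i (fun t => coord_vec (iter t (sigma_map A) x) ord0 i) ^+ m i.
    apply/funext => t; rewrite /coord_eval mevalE fct_sumE; apply: eq_bigr => m _.
    rewrite mulrfctE fct_prodE; congr (_ * _); apply: eq_bigr => i _.
    by rewrite exprfctE.
  rewrite rmorph_sum; apply: rpred_sum => m _; rewrite rmorphM; apply: rpredM.
    by apply: Seq_constant_in_subalgebra; rewrite Seq_shiftE.
  by rewrite rmorph_prod; apply: rpred_prod => i _; rewrite rmorphXn; apply: rpredX; apply: coordL.
have inX : ultimately (fun i => in_X (iter i (sigma_map A) x)).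
  by exists N => i Ni; rewrite /in_X -/(B i) Bu.
(* Each equation has ultimately periodic zeros along the orbit, and [E] is a finite list. *)
have : ultimately_periodic (fun i => {in E, forall P, coord_eval P (iter i (sigma_map A) x) = 0}).
  elim: E => [|P E' IH]; first by exists 1%N => //; exists 0%N => i _; split=> _ P.
  have Pper : ultimately_periodic (fun i => coord_eval P (iter i (sigma_map A) x) = 0).
    apply: ultimately_iff (pseudo_field_periodic pf (evalL P)).
    have := repr_to_Seq (fun t => coord_eval P (iter t (sigma_map A) x)).
    by apply: ultimatelyW => i ->.
  apply: ultimately_iff (ultimately_periodicI Pper IH); apply: ultimatelyT => i.
  split=> [[P0 E0] Q|PE0].
    by rewrite inE => /orP[/eqP->|/E0].
  by split=> [|Q QE]; apply: PE0; rewrite inE ?eqxx // QE orbT.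
apply: ultimately_iff; apply: ultimatelyW inX => i iX.
by split=> [|[]].
Qed.
End Orbits.

Theorem theorem4p1 (k : fieldType) (k0 : [pchar k] =i pred0) :
  [<->
    (* (i) *)
    forall (n : nat) (A : 'M[{fraction {poly k}}]_n),
      (0 < n)%N -> A \in unitmx ->
      forall (E : seq {mpoly k[1 + n * n + 1]}) (x : k * 'M[k]_n),
        in_X x -> orbit_defined A x ->
        finite_union_of_AP (fun i => zero_locus E (iter i (sigma_map A) x));
    (* (ii) *)
    forall (n : nat) (h : 'I_n -> {fraction {poly k}}) (f : nat -> k),
      (0 < n)%N ->
      (exists N, forall i, (N <= i)%N ->
        f (i + n)%N + \sum_(j < n) frac_eval (h j) i%:R * f (i + j)%N = 0) ->
      finite_union_of_AP (fun i => f i = 0);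
    (* (iii) *)
    forall (n : nat) (A : 'M[{fraction {poly k}}]_n),
      (0 < n)%N -> A \in unitmx ->
      exists L : sigma_subalgebra (@Seq_shift k) (frac_to_Seq k0),
        picard_vessiot (@frac_shift k) (@sub_sigma _ _ _ _ L)
          (@sub_iota _ _ _ _ L) A ].
Proof.
tfae=> [orbits n h f n0 rec|zeros n A n0 Au|pv n A n0 Au E x _ _].
- exact/finite_union_of_APP/(recurrence_zeros_of_orbits k0 orbits rec).
- exact: (exists_picard_vessiot k0 zeros Au).
- exact: (orbit_zero_locus_of_picard_vessiot pv n0 Au E x).
Qed.
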